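(* Let $s,s'\in[0,1]$. Then the inequality $$|||H_s(S,T)X|||\le|||H_{s'}(S,T)X|||$$ holds for all $n\in\mathbb{N}$, all unitarily invariant norms $|||\cdot|||$ on $M_n(\mathbb{C})$, all positive semi-definite $S,T\in M_n(\mathbb{C})$ and all $X\in M_n(\mathbb{C})$, if and only if $s\ge s'$ and $s'\le\frac12$.
   Context: $M_n(\mathbb{C})$ is the set of $n\times n$ complex matrices. A norm $|||\cdot|||$ on $M_n(\mathbb{C})$ is unitarily invariant if $|||UXV|||=|||X|||$ for all unitary $U,V$ and all $X$. The Heron mean is $H_s(a,b)=s\sqrt{ab}+(1-s)\frac{a+b}{2}$ for $0\le s\le1$. For positive semi-definite $S,T\in M_n(\mathbb{C})$ with $S=U\,\mathrm{diag}(\lambda_1,\dots,\lambda_n)U^*$, $T=V\,\mathrm{diag}(\mu_1,\dots,\mu_n)V^*$ ($U,V$ unitary), and $X\in M_n(\mathbb{C})$, define $H_s(S,T)X:=U\left([H_s(\lambda_i,\mu_j)]_{i,j=1,\dots,n}\circ(U^*XV)\right)V^*$, where $\circ$ is the Hadamard (entrywise) product. (Thus $H_s(S,T)X=s\,S^{1/2}XT^{1/2}+(1-s)\frac{SX+XT}{2}$.)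
   Formalization: The right-hand side is ''s = s', or s ≥ s' and s' ≤ 1/2'': the printed equivalence fails for s = s' > 1/2 (e.g. s = s' = 1), where the inequality is a trivial equality though s' ≤ 1/2 is false; for s ≠ s' the claim is unchanged. *)

(* Defs.v *)
From mathcomp Require Import all_boot all_order all_algebra.
From mathcomp Require Import spectral sesquilinear.
From mathcomp Require Import complex.
From mathcomp Require Import reals.

Set Implicit Arguments.
Unset Strict Implicit.
Unset Printing Implicit Defensive.

Import Order.TTheory GRing.Theory Num.Theory.
Local Open Scope ring_scope.
Local Open Scope sesquilinear_scope.
Local Open Scope complex_scope.

Definition unitarily_invariant_norm (R : realType) (n : nat)
    (N : 'M[R[i]]_n -> R) : Prop :=
  [/\ forall A, 0 <= N A,
      forall A, N A = 0 -> A = 0,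
      forall (c : R[i]) A, N (c *: A) = ComplexField.Normc.normc c * N A,
      forall A B, N (A + B) <= N A + N B
    & forall U A V, U \is unitarymx -> V \is unitarymx ->
        N (U *m A *m V) = N A].

Definition psdmx (R : realType) (n : nat) (A : 'M[R[i]]_n) : Prop :=
  A \is hermsymmx /\ forall x : 'cV[R[i]]_n, 0 <= (x^t* *m A *m x) 0 0.

Definition heron_mean (R : realType) (s a b : R) : R :=
  s * Num.sqrt (a * b) + (1 - s) * ((a + b) / 2).

Definition heron_diag (R : realType) (n : nat) (s : R)
    (U : 'M[R[i]]_n) (lam : 'rV[R]_n) (V : 'M[R[i]]_n) (mu : 'rV[R]_n)
    (X : 'M[R[i]]_n) : 'M[R[i]]_n :=
  U *m map2_mx *%R (\matrix_(i, j) (heron_mean s (lam 0 i) (mu 0 j))%:C)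
                   (U^t* *m X *m V) *m V^t*.

Definition real_spectrum (R : realType) (n : nat) (S : 'M[R[i]]_n) : 'rV[R]_n :=
  map_mx (@complex.Re R) (spectral_diag S).

(* [spectralmx S] is the inverse of the unitary matrix that diagonalizes [S];
   by [heron_opE] below, any other diagonalization gives the same result. *)
Definition heron_op (R : realType) (n : nat) (s : R) (S T X : 'M[R[i]]_n) :
    'M[R[i]]_n :=
  heron_diag s ((spectralmx S)^t*) (real_spectrum S)
               ((spectralmx T)^t*) (real_spectrum T) X.

Section Diagonalization.
Variables (C : numClosedFieldType) (n : nat).
Implicit Types (S X U V P Q : 'M[C]_n) (a b c d : 'rV[C]_n).

Lemma unitarymx_mulVmx U : U \is unitarymx -> U^t* *m U = 1%:M.
Proof. by move=> uU; rewrite -invmx_unitary ?mulVmx ?unitarymx_unit. Qed.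

Lemma diag_intertwine U P a b : U \is unitarymx -> P \is unitarymx ->
  U *m diag_mx a *m U^t* = P *m diag_mx b *m P^t* ->
  forall i k, (P^t* *m U) i k != 0 -> a 0 k = b 0 i.
Proof.
move=> uU uP eqS i k Wik.
have : P^t* *m U *m diag_mx a = diag_mx b *m (P^t* *m U).
  have /(congr1 (fun M => P^t* *m M *m U)) := eqS.
  rewrite !mulmxA unitarymx_mulVmx // mul1mx => <-.
  by rewrite -!mulmxA unitarymx_mulVmx // mulmx1.
move/matrixP/(_ i k); rewrite mul_mx_diag mul_diag_mx !mxE [RHS]mulrC.
by move=> /mulfI; apply; move: Wik; rewrite mxE.
Qed.

Lemma schur_diag_uniq (f : C -> C -> C) U a P b V c Q d X :
  U \is unitarymx -> P \is unitarymx -> V \is unitarymx -> Q \is unitarymx ->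
  U *m diag_mx a *m U^t* = P *m diag_mx b *m P^t* ->
  V *m diag_mx c *m V^t* = Q *m diag_mx d *m Q^t* ->
  U *m map2_mx *%R (\matrix_(i, j) f (a 0 i) (c 0 j)) (U^t* *m X *m V) *m V^t*
  = P *m map2_mx *%R (\matrix_(i, j) f (b 0 i) (d 0 j)) (P^t* *m X *m Q)
      *m Q^t*.
Proof.
move=> uU uP uV uQ eS eT.
have PP : P *m P^t* = 1%:M by apply/unitarymxP.
have QQ : Q *m Q^t* = 1%:M by apply/unitarymxP.
have UU : U *m U^t* = 1%:M by apply/unitarymxP.
have VV : V *m V^t* = 1%:M by apply/unitarymxP.
set Y := U^t* *m X *m V; set M := map2_mx _ _ Y.
rewrite -[LHS]mul1mx -PP -[LHS]mulmx1 -QQ.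
rewrite -!mulmxA; congr (_ *m _); rewrite !mulmxA; congr (_ *m _).
have -> : P^t* *m X *m Q = (P^t* *m U) *m Y *m (V^t* *m Q).
  by rewrite /Y !mulmxA -(mulmxA (P^t*) U) UU mulmx1 -(mulmxA _ V) VV mulmx1.
rewrite -[LHS](mulmxA _ (V^t*)).
have hW := diag_intertwine uU uP eS.
have hZ := diag_intertwine uQ uV (esym eT).
move: (P^t* *m U) (V^t* *m Q) hW hZ => W Z hW hZ.
apply/matrixP => i j; rewrite !mxE mulr_sumr; apply: eq_bigr => l _.
rewrite !mxE !mulr_suml mulr_sumr; apply: eq_bigr => k _; rewrite !mxE.
have [->|Wik] := eqVneq (W i k) 0; first by rewrite !(mul0r, mulr0).
have [->|Zlj] := eqVneq (Z l j) 0; first by rewrite !(mul0r, mulr0).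
by rewrite (hW _ _ Wik) (hZ _ _ Zlj) !mulrA (mulrC (W i k)).
Qed.

Lemma real_diag_hermsym U a : a \is a realmx ->
  U *m diag_mx a *m U^t* \is hermsymmx.
Proof.
move=> /mxOverP ra; apply/is_hermitianmxP; rewrite expr0 scale1r.
rewrite !trmx_mul !map_mxM /= tr_diag_mx map_diag_mx trmxCK -mulmxA.
congr (_ *m (diag_mx _ *m _)); apply/rowP => i; rewrite !mxE.
by apply/esym/conj_Creal.
Qed.

Lemma hermsym_spectral S : S \is hermsymmx ->
  S = (spectralmx S)^t* *m diag_mx (spectral_diag S) *m (spectralmx S)^t*^t*.
Proof.
move=> hS; have /orthomx_spectralP {1}-> := hermitian_normalmx hS.
by rewrite trmxCK invmx_unitary ?spectral_unitarymx.
Qed.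

Lemma schur_spectral_uniq (f : C -> C -> C) S T U a V c X :
  U \is unitarymx -> V \is unitarymx -> a \is a realmx -> c \is a realmx ->
  S = U *m diag_mx a *m U^t* -> T = V *m diag_mx c *m V^t* ->
  let P := (spectralmx S)^t* in let b := spectral_diag S in
  let Q := (spectralmx T)^t* in let d := spectral_diag T in
  P *m map2_mx *%R (\matrix_(i, j) f (b 0 i) (d 0 j)) (P^t* *m X *m Q) *m Q^t*
  = U *m map2_mx *%R (\matrix_(i, j) f (a 0 i) (c 0 j)) (U^t* *m X *m V)
      *m V^t*.
Proof.
move=> uU uV ra rc eS eT P b Q d.
apply: schur_diag_uniq; rewrite ?trmxC_unitary ?spectral_unitarymx //.
  by rewrite -hermsym_spectral eS // real_diag_hermsym.
by rewrite -hermsym_spectral eT // real_diag_hermsym.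
Qed.

End Diagonalization.

Lemma heron_opE (R : realType) (n : nat) (s : R) (S T X U V : 'M[R[i]]_n)
    (lam mu : 'rV[R]_n) :
  U \is unitarymx -> V \is unitarymx ->
  S = U *m diag_mx (map_mx (real_complex R) lam) *m U^t* ->
  T = V *m diag_mx (map_mx (real_complex R) mu) *m V^t* ->
  heron_op s S T X = heron_diag s U lam V mu X.
Proof.
have r (v : 'rV[R]_n) : map_mx (real_complex R) v \is a realmx.
  by apply/mxOverP => i j; rewrite mxE; apply/complex_realP; exists (v i j).
move=> uU uV eS eT.
have := schur_spectral_uniq (fun x y : R[i] => (heron_mean s (complex.Re x) (complex.Re y))%:C) X
  uU uV (r lam) (r mu) eS eT.
cbv zeta => H; rewrite /heron_op /heron_diag.
have -> : \matrix_(i, j) (heron_mean s (lam 0 i) (mu 0 j))%:C =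
    \matrix_(i, j) (heron_mean s
      (complex.Re (map_mx (real_complex R) lam 0 i))
      (complex.Re (map_mx (real_complex R) mu 0 j)))%:C :> 'M_n.
  by apply/matrixP => i j; rewrite !mxE.
have -> : \matrix_(i, j) (heron_mean s (real_spectrum S 0 i)
      (real_spectrum T 0 j))%:C =
    \matrix_(i, j) (heron_mean s (complex.Re (spectral_diag S 0 i))
      (complex.Re (spectral_diag T 0 j)))%:C :> 'M_n.
  by apply/matrixP => i j; rewrite !mxE.
exact: H.
Qed.

(* Main.v *)
Require Import Defs.
From mathcomp Require Import all_boot all_order all_algebra.
From mathcomp Require Import spectral sesquilinear.
From mathcomp Require Import complex.
From mathcomp Require Import reals.
From mathcomp Require Import fingroup perm.
From mathcomp Require Import ring lra.
From mathcomp Require Import boolp classical_sets topology normedtype sequences.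
From mathcomp Require Import derive realfun exp trigo.

(** Diagonalizing [S] and [T] turns the operator into entrywise multiplication
by the matrix of means of the eigenvalues: up to unitary factors, which the
norm ignores, the claim compares two such Schur multipliers.  Write
[lam_i = a_i ^ 2], [mu_j = b_j ^ 2].

Sufficiency.  With [al = (1 - s) / (1 - s')] one has
[H_s = al H_s' + (1 - al) a b], a convex combination, so it is enough to show
that multiplying by the geometric mean [a b] yields a smaller norm than
multiplying by [H_s'].  Equivalently, multiplication by
[(a^2 + b^2 + 2 be a b) / (2 (1 + be) a b)], where [be = s' / (1 - s') <= 1],
does not decrease the norm ([quad_expansive]).  In logarithmic coordinates this
multiplier is [(be + cosh t) / (be + 1)].  One classically quotes that its
inverse is the Fourier transform of a probability measure; here the same fact
is reached without integrals.
- Multiplying row [i] by [z_i] and column [j] by the conjugate of [w_j], all of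
  modulus one, is an isometry, so the multiplier [1 + ka (1 - Re (z_i w_j^* ))]
  is expansive for [ka >= 0]: its inverse is an infinite convex combination of
  isometries ([seminorm_oscillation]).
- Take [z], [w] to be the Cayley transforms of [a], [b].  When all [a_i], [b_j]
  lie in [[1, 1 + tau]], this is the wanted multiplier up to entries of
  size [tau ^ 4] ([quad_expansive_near1]).
- The factorization
  [p^4 + q^4 + 2 be p^2 q^2 = (p^2 + q^2 + 2 si p q) (p^2 + q^2 - 2 si p q)],
  [si ^ 2 = (1 - be) / 2], stays in the range [-1 < be <= 1] and halves [tau].
  Iterating it [m] times leaves a total error of order [4 ^ -m]
  ([quad_expansive_approx]).

Necessity.  Test the inequality on the trace norm
[A |-> sup_U |tr (U A)|], with [S = T] diagonal and [X] such that
[H_s' (S, S) X] is the all-ones matrix, of trace norm at most [n].  Against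
Householder reflections this forces the function
[t |-> (s + (1 - s) cosh t) / (s' + (1 - s') cosh t)] to be positive definite
([contractive_posdef]).  Comparing its values at two points gives [s' <= s].
If moreover [1/2 < s' < s], this function is [c0 + c1 / (be + cosh t)] with
[c1 > 0] and [be > 1], which is not positive definite ([not_posdef]).  Indeed,
if [K] is positive definite so is [- K''], hence the even derivatives of
[1 / (be + cosh t)] at [0] have alternating signs.  These are, up to sign, the
derivatives at [0] of its continuation [1 / (be + cos x)] to the imaginary
axis, which therefore has only nonnegative derivatives at [0].  That function
is analytic on the whole line with a uniform radius of convergence, so its
derivatives would be nonnegative on all of [[0, +oo[] ([abs_monotone]), as in
the theorem of Pringsheim; but it is decreasing at [3 pi / 2]. *)

Set Implicit Arguments.
Unset Strict Implicit.
Unset Printing Implicit Defensive.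

Import Order.TTheory GRing.Theory Num.Theory.
Import numFieldNormedType.Exports.
Local Open Scope classical_set_scope.
Local Open Scope ring_scope.
Local Open Scope sesquilinear_scope.
Local Open Scope complex_scope.
Import ComplexField.Normc.

(** * Elementary facts *)

(** Closes both limit arguments below: an error that decays geometrically in
the number of iterations vanishes. *)
Lemma le0_geometric (R : realType) (c : nat) (e A : R) : (1 < c)%N ->
  (forall k, e * c%:R ^+ k <= A) -> e <= 0.
Proof.
move=> c1 h; have [//|e0] := leP e 0.
have A0 : 0 <= A by have := h 0; rewrite expr0; lra.
have := archi_boundP (divr_ge0 A0 (ltW e0)); set m := Num.bound _.
rewrite ltr_pdivrMr // => hm; have := h m.
have mc : m%:R <= c%:R ^+ m :> R by rewrite -natrX ler_nat ltnW // ltn_expl.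
have : m%:R * e <= c%:R ^+ m * e by rewrite ler_wpM2r // ltW.
lra.
Qed.

Lemma conj_conjc (R : realType) (z : R[i]) : Num.conj z = conjc z.
Proof. by []. Qed.

Lemma normc_real (R : realType) (r : R) : normc r%:C = `|r|.
Proof. by rewrite /normc /= expr0n addr0 sqrtr_sqr. Qed.

(** The axioms behind the masking lemma [seminorm_mask], which in turn yields
the definiteness of the trace norm: hence the separation from norms. *)
Definition unitarily_invariant_seminorm (R : realType) (n : nat)
    (N : 'M[R[i]]_n -> R) : Prop :=
  [/\ forall c A, N (c *: A) = normc c * N A,
      forall A B, N (A + B) <= N A + N B
    & forall U A V, U \is unitarymx -> V \is unitarymx ->
        N (U *m A *m V) = N A].

(** * Schur multipliers and unitarily invariant seminorms *)

Definition rschur (R : realType) (n : nat) (r : 'I_n -> 'I_n -> R)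
    (Z : 'M[R[i]]_n) : 'M[R[i]]_n := \matrix_(i, j) ((r i j)%:C * Z i j).

Section Seminorm.
Variables (R : realType) (n : nat) (N : 'M[R[i]]_n -> R).
Hypothesis hN : unitarily_invariant_seminorm N.
Local Notation C := R[i].
Implicit Types (Z : 'M[C]_n).

Let N_scale c A : N (c *: A) = normc c * N A. Proof. by case: hN. Qed.
Let N_tri A B : N (A + B) <= N A + N B. Proof. by case: hN. Qed.
Let N_inv U A V : U \is unitarymx -> V \is unitarymx -> N (U *m A *m V) = N A.
Proof. by case: hN => _ _; apply. Qed.

Lemma seminorm_rscale (r : R) A : N (r%:C *: A) = `|r| * N A.
Proof. by rewrite N_scale normc_real. Qed.

Lemma seminorm0 : N 0 = 0.
Proof. by rewrite -(scale0r 0) N_scale normc0 mul0r. Qed.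

Lemma seminormN A : N (- A) = N A.
Proof.
by rewrite -scaleN1r -(rmorphN1 (real_complex R)) seminorm_rscale normrN1 mul1r.
Qed.

Lemma seminorm_ge0 A : 0 <= N A.
Proof.
have := N_tri A (- A); rewrite subrr seminorm0 seminormN -mulr2n.
by rewrite pmulrn_lge0.
Qed.

Lemma seminorm_sum (I : Type) (s : seq I) (F : I -> 'M[C]_n) :
  N (\sum_(i <- s) F i) <= \sum_(i <- s) N (F i).
Proof.
elim: s => [|x s IH]; first by rewrite !big_nil seminorm0.
by rewrite !big_cons (le_trans (N_tri _ _)) // lerD2l.
Qed.

Lemma diag_unimodular_unitary (z : 'I_n -> C) :
  (forall i, z i * (z i)^*%C = 1) -> diag_mx (\row_i z i) \is unitarymx.
Proof.
move=> hz; apply/unitarymxP/matrixP => i j.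
rewrite mul_diag_mx !mxE conj_conjc.
case: (eqVneq i j) => [->|nij]; first by rewrite ?eqxx mulr1n hz.
by rewrite ?(eq_sym j) ?(negPf nij) mulr0n conjc0 mulr0.
Qed.

(** Diagonal unitary factors: this is the only form in which the invariance of
the seminorm enters the sufficiency part. *)
Lemma seminorm_phases (z w : 'I_n -> C) Z :
  (forall i, z i * (z i)^*%C = 1) -> (forall j, w j * (w j)^*%C = 1) ->
  N (\matrix_(i, j) (z i * w j * Z i j)) = N Z.
Proof.
move=> hz hw.
rewrite -(N_inv Z (diag_unimodular_unitary hz) (diag_unimodular_unitary hw)).
congr N; apply/matrixP => i j; rewrite mul_mx_diag mul_diag_mx !mxE; ring.
Qed.

(** Restricting to a block is an average of two isometries on each side, since
a diagonal projection is the mean of the identity and a diagonal reflection. *)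
Lemma seminorm_mask (p q : pred 'I_n) Z :
  N (\matrix_(i, j) (if p i && q j then Z i j else 0)) <= N Z.
Proof.
pose half : C := (2^-1 : R)%:C.
have avg A B : N A = N Z -> N B <= N Z -> N (half *: (A + B)) <= N Z.
  move=> eA leB; rewrite seminorm_rscale ger0_norm ?invr_ge0 ?ler0n //.
  have := N_tri A B; lra.
pose sg (b : bool) : C := if b then 1 else -1.
have sgP b : sg b * (sg b)^*%C = 1.
  by case: b; rewrite /sg ?rmorphN ?rmorph1 ?mulrNN mulr1.
have one : (1 : C) * 1^*%C = 1 by rewrite rmorph1 mulr1.
have hh : half + half = 1.
  by rewrite /half -rmorphD /= -[RHS](rmorph1 (real_complex R)); congr (_%:C); lra.
pose W := \matrix_(i, j) (if p i then Z i j else 0).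
have leW : N W <= N Z.
  suff -> : W = half *: (Z + \matrix_(i, j) (sg (p i) * 1 * Z i j)).
    by apply: avg => //; rewrite (@seminorm_phases (fun i => sg (p i)) (fun=> 1)).
  apply/matrixP => i j; rewrite !mxE /sg; case: (p i).
    by rewrite !mul1r mulrDr -mulrDl hh mul1r.
  by rewrite mulr1 mulN1r subrr mulr0.
apply: le_trans leW.
have -> : \matrix_(i, j) (if p i && q j then Z i j else 0) =
    half *: (W + \matrix_(i, j) (1 * sg (q j) * W i j)).
  apply/matrixP => i j; rewrite !mxE /sg; case: (p i) => /=;
    last by rewrite mulr0 addr0 mulr0.
  case: (q j); first by rewrite !mul1r mulrDr -mulrDl hh mul1r.
  by rewrite mul1r mulN1r subrr mulr0.
rewrite seminorm_rscale ger0_norm ?invr_ge0 ?ler0n //.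
have := N_tri W (\matrix_(i, j) (1 * sg (q j) * W i j)).
by rewrite (@seminorm_phases (fun=> 1) (fun j => sg (q j))) //; lra.
Qed.

(** A crude bound, one term per matrix entry.  The dimension factor is harmless
since it is only applied to errors that tend to zero. *)
Lemma seminorm_rschur_le (r : 'I_n -> 'I_n -> R) (rho : R) Z :
  (forall i j, `|r i j| <= rho) -> N (rschur r Z) <= n%:R ^+ 2 * rho * N Z.
Proof.
move=> hr.
pose E i j : 'M[C]_n := \matrix_(k, l) (if (k == i) && (l == j) then Z k l else 0).
have -> : rschur r Z = \sum_i \sum_j (r i j)%:C *: E i j.
  apply/matrixP => k l; rewrite summxE (bigD1 k) //= summxE (bigD1 l) //= !mxE !eqxx /=.
  rewrite [X in _ + X + _]big1 ?[X in _ + _ + X]big1 ?addr0 // => [i nik|j njl].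
    by rewrite summxE big1 // => j _; rewrite !mxE (eq_sym k) (negPf nik) mulr0.
  by rewrite !mxE (eq_sym l) (negPf njl) andbF mulr0.
apply: le_trans (seminorm_sum _ _) _.
have -> : n%:R ^+ 2 * rho * N Z = \sum_(i < n) \sum_(j < n) (rho * N Z).
  by rewrite !sumr_const card_ord -mulrnA -[RHS]mulr_natl natrM; ring.
apply: ler_sum => i _; apply: le_trans (seminorm_sum _ _) _.
apply: ler_sum => j _; rewrite seminorm_rscale.
apply: ler_pM => //; first exact: seminorm_ge0.
exact: (seminorm_mask (pred1 i) (pred1 j)).
Qed.

(** With [W] the isometry [Z |-> (z_i w_j^* Z_ij)], the multiplier is
[(1 + ka) - ka (W + W^-1) / 2], and [N ((1 + ka) Z)] is at most the norm of its
value plus [ka N Z]. *)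
Lemma seminorm_oscillation (ka : R) (z w : 'I_n -> C) Z : 0 <= ka ->
  (forall i, z i * (z i)^*%C = 1) -> (forall j, w j * (w j)^*%C = 1) ->
  N Z <= N (rschur (fun i j => 1 + ka * (1 - complex.Re (z i * (w j)^*%C))) Z).
Proof.
move=> ka0 hz hw; set A := rschur _ _.
have hz' i : (z i)^*%C * ((z i)^*%C)^*%C = 1 by rewrite conjcK mulrC.
have hw' i : (w i)^*%C * ((w i)^*%C)^*%C = 1 by rewrite conjcK mulrC.
pose B := \matrix_(i, j) (z i * (w j)^*%C * Z i j).
pose B' := \matrix_(i, j) ((z i)^*%C * w j * Z i j).
have eB : N B = N Z by exact: (@seminorm_phases z (fun j => (w j)^*%C)).
have eB' : N B' = N Z by exact: (@seminorm_phases (fun i => (z i)^*%C) w).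
have e : (1 + ka)%:C *: Z = A + (ka / 2)%:C *: (B + B').
  apply/matrixP => i j; rewrite !mxE.
  have -> : (z i)^*%C * w j = ((z i * (w j)^*%C)^*)%C by rewrite rmorphM /= conjcK.
  rewrite -[z i * _ * Z i j + _]mulrDl addcJ.
  rewrite -(rmorph_nat (real_complex R)) mulrA mulrA -!rmorphM -mulrDl -rmorphD.
  by congr (_%:C * _); field.
have : N ((1 + ka)%:C *: Z) <= N A + ka / 2 * (N Z + N Z).
  rewrite e (le_trans (N_tri _ _)) // lerD2l seminorm_rscale.
  rewrite ger0_norm ?divr_ge0 ?ler0n // ler_wpM2l ?divr_ge0 ?ler0n //.
  by rewrite (le_trans (N_tri _ _)) // eB eB'.
rewrite seminorm_rscale ger0_norm ?addr_ge0 ?ler01 //; lra.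
Qed.

End Seminorm.

(** * Expansive multipliers *)

(** The quotient of [(a^2 + b^2) / 2 + be a b] by its geometric part, normalized
to be [1] on the diagonal; for [a = exp x], [b = exp y] it is
[(be + cosh (x - y)) / (be + 1)]. *)
Definition quad_ratio (R : realType) (be a b : R) : R :=
  (a ^+ 2 + b ^+ 2 + 2 * be * a * b) / (2 * (1 + be) * a * b).

(** The double angle formula [cosh (2 t) + be = 2 (cosh t + si) (cosh t - si)]
in multiplicative form. *)
Lemma quad_ratio_double (R : realType) (be si p q : R) :
  be = 1 - 2 * si ^+ 2 -> 0 < 1 - si ^+ 2 -> 0 < p -> 0 < q ->
  quad_ratio be (p ^+ 2) (q ^+ 2) = quad_ratio si p q * quad_ratio (- si) p q.
Proof.
move=> -> si1 p0 q0; rewrite /quad_ratio; field.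
have : 1 - si ^+ 2 = (1 + si) * (1 - si) by ring.
move=> e; move: si1; rewrite e => /lt0r_neq0; rewrite mulf_eq0 negb_or => /andP[h1 h2].
rewrite ?(gt_eqF p0) ?(gt_eqF q0) ?h1 ?h2 /=.
have -> : 1 + (1 - 2 * si ^+ 2) = 2 * ((1 + si) * (1 - si)) by ring.
by rewrite !mulf_neq0 // pnatr_eq0.
Qed.

(** The error bound of [quad_expansive_approx] is invariant under doubling: the
two factors with parameters [si] and [- si], at half the spread, contribute
together exactly a quarter of the error for [be]. *)
Lemma error_split (R : realType) (be si D t M : R) :
  be = 1 - 2 * si ^+ 2 -> 0 < 1 - si ^+ 2 -> 0 < M ->
  D * t ^+ 4 / (1 + be) / (4 * M) =
  D * (t / 2) ^+ 4 / (1 + si) / M + D * (t / 2) ^+ 4 / (1 + - si) / M.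
Proof.
have e : 1 - si ^+ 2 = (1 + si) * (1 - si) by ring.
move=> ->; rewrite e => si1 M0; move: (si1) => /lt0r_neq0.
rewrite mulf_eq0 negb_or => /andP[h1 h2].
field; rewrite h1 h2 (gt_eqF M0) /=.
have -> : 1 + (1 - 2 * si ^+ 2) = 2 * ((1 + si) * (1 - si)) by ring.
by rewrite mulf_neq0 ?mulf_neq0 ?pnatr_eq0.
Qed.

(** The middle term is the oscillation of the Cayley transforms (see
[cayley_gap]).  The last one is of fourth order near [a = b = 1], because
[(1 + a^2) (1 + b^2) - 4 a b = (1 - a b)^2 + (a - b)^2]. *)
Lemma cayley_expansion (R : realType) (be a b : R) : -1 < be -> 0 < a -> 0 < b ->
  quad_ratio be a b =
    1 + (1 + be)^-1 * (2 * (a - b) ^+ 2 / ((1 + a ^+ 2) * (1 + b ^+ 2)))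
    + (1 + be)^-1 * ((a - b) ^+ 2 * ((1 - a * b) ^+ 2 + (a - b) ^+ 2)
                     / (2 * (a * b * ((1 + a ^+ 2) * (1 + b ^+ 2))))).
Proof.
move=> be1 a0 b0; rewrite /quad_ratio; field.
have ne x : 1 + x ^+ 2 != 0 :> R by rewrite gt_eqF // ltr_pwDl ?ltr01 ?sqr_ge0.
have h : 1 + be != 0 by rewrite gt_eqF //; lra.
by rewrite !ne h (gt_eqF a0) (gt_eqF b0).
Qed.

Lemma cayley_remainder_le (R : realType) (T tau a b : R) :
  tau <= T -> 1 <= a <= 1 + tau -> 1 <= b <= 1 + tau ->
  `|(a - b) ^+ 2 * ((1 - a * b) ^+ 2 + (a - b) ^+ 2)
     / (2 * (a * b * ((1 + a ^+ 2) * (1 + b ^+ 2))))|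
  <= ((2 + T) ^+ 2 + 1) * tau ^+ 4.
Proof.
move=> tT /andP[a1 at1] /andP[b1 bt1].
have t0 : 0 <= tau by lra.
have ab1 : 1 <= a * b by nra.
have aa1 : 1 <= 1 + a ^+ 2 by rewrite lerDl sqr_ge0.
have bb1 : 1 <= 1 + b ^+ 2 by rewrite lerDl sqr_ge0.
have den : 1 <= 2 * (a * b * ((1 + a ^+ 2) * (1 + b ^+ 2))).
  have h : 1 <= (1 + a ^+ 2) * (1 + b ^+ 2) by rewrite mulr_ege1.
  have h2 : 1 <= a * b * ((1 + a ^+ 2) * (1 + b ^+ 2)) by rewrite mulr_ege1.
  lra.
have d2 : (a - b) ^+ 2 <= tau ^+ 2.
  nra.
have p2 : (1 - a * b) ^+ 2 <= ((2 + T) * tau) ^+ 2.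
  have : a * b <= (1 + tau) * (1 + tau) by apply: ler_pM => //; lra.
  move=> h; have h1 : a * b - 1 <= (2 + T) * tau by nra.
  have : (a * b - 1) ^+ 2 <= ((2 + T) * tau) ^+ 2 by rewrite lerXn2r // nnegrE; lra.
  by rewrite -sqrrN opprB.
have num0 : 0 <= (a - b) ^+ 2 * ((1 - a * b) ^+ 2 + (a - b) ^+ 2).
  by rewrite mulr_ge0 ?addr_ge0 ?sqr_ge0.
rewrite ger0_norm; last by rewrite divr_ge0 //; lra.
rewrite ler_pdivrMr; last lra.
have -> : ((2 + T) ^+ 2 + 1) * tau ^+ 4 = tau ^+ 2 * (((2 + T) * tau) ^+ 2 + tau ^+ 2).
  ring.
apply: le_trans (_ : tau ^+ 2 * (((2 + T) * tau) ^+ 2 + tau ^+ 2) <= _).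
  by apply: ler_pM; rewrite ?addr_ge0 ?sqr_ge0 // lerD.
by rewrite ler_peMr // mulr_ge0 ?addr_ge0 ?sqr_ge0.
Qed.

(** The point [(1 + i a) / (1 - i a)] of the unit circle. *)
Definition cayley (R : realType) (a : R) : R[i] :=
  Complex ((1 - a ^+ 2) / (1 + a ^+ 2)) (2 * a / (1 + a ^+ 2)).

Lemma cayley_unimodular (R : realType) (a : R) : cayley a * (cayley a)^*%C = 1.
Proof.
have ne : 1 + a ^+ 2 != 0 by rewrite gt_eqF // ltr_pwDl ?ltr01 ?sqr_ge0.
by apply/eqP; rewrite eq_complex /=; apply/andP; split; apply/eqP; field.
Qed.

Lemma cayley_gap (R : realType) (a b : R) :
  1 - complex.Re (cayley a * (cayley b)^*%C) =
  2 * (a - b) ^+ 2 / ((1 + a ^+ 2) * (1 + b ^+ 2)).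
Proof.
have ne x : 1 + x ^+ 2 != 0 :> R by rewrite gt_eqF // ltr_pwDl ?ltr01 ?sqr_ge0.
by rewrite /=; field; rewrite !ne.
Qed.

Section Expansion.
Variables (R : realType) (n : nat) (N : 'M[R[i]]_n -> R).
Hypothesis hN : unitarily_invariant_seminorm N.
Local Notation C := R[i].
Implicit Types (Z : 'M[C]_n) (a b : 'I_n -> R).

Let N_ge0 := seminorm_ge0 hN.

Lemma rschurD (r1 r2 : 'I_n -> 'I_n -> R) Z :
  rschur (fun i j => r1 i j + r2 i j) Z = rschur r1 Z + rschur r2 Z.
Proof. by apply/matrixP => i j; rewrite !mxE rmorphD mulrDl. Qed.

Lemma rschurM (r1 r2 : 'I_n -> 'I_n -> R) Z :
  rschur (fun i j => r1 i j * r2 i j) Z = rschur r1 (rschur r2 Z).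
Proof. by apply/matrixP => i j; rewrite !mxE rmorphM mulrA. Qed.

Lemma eq_rschur (r1 r2 : 'I_n -> 'I_n -> R) Z :
  (forall i j, r1 i j = r2 i j) -> rschur r1 Z = rschur r2 Z.
Proof. by move=> h; apply/matrixP => i j; rewrite !mxE h. Qed.

(** First-order comparison of the multiplier with an exactly expansive one. *)
Lemma quad_expansive_near1 (T tau be : R) a b Z : -1 < be -> tau <= T ->
  (forall i, 1 <= a i <= 1 + tau) -> (forall j, 1 <= b j <= 1 + tau) ->
  (1 - n%:R ^+ 2 * ((2 + T) ^+ 2 + 1) * tau ^+ 4 / (1 + be)) * N Z
  <= N (rschur (fun i j => quad_ratio be (a i) (b j)) Z).
Proof.
move=> be1 tT ha hb.
pose r i j : R := (1 + be)^-1 *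
  ((a i - b j) ^+ 2 * ((1 - a i * b j) ^+ 2 + (a i - b j) ^+ 2)
   / (2 * (a i * b j * ((1 + a i ^+ 2) * (1 + b j ^+ 2))))).
have ka0 : 0 <= (1 + be)^-1 by rewrite invr_ge0; lra.
have := seminorm_oscillation hN Z ka0 (fun i => cayley_unimodular (a i))
  (fun j => cayley_unimodular (b j)).
set A := rschur _ Z => leA.
set M := rschur _ Z.
have eM : M = A + rschur r Z.
  rewrite -rschurD; apply: eq_rschur => i j.
  have /andP[a1 _] := ha i; have /andP[b1 _] := hb j.
  by rewrite cayley_expansion ?cayley_gap //; lra.
have leR : N (rschur r Z) <=
    n%:R ^+ 2 * ((1 + be)^-1 * (((2 + T) ^+ 2 + 1) * tau ^+ 4)) * N Z.
  apply: seminorm_rschur_le => // i j; rewrite normrM (ger0_norm ka0).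
  by apply: ler_wpM2l => //; apply: cayley_remainder_le.
have : N A <= N M + N (rschur r Z).
  have -> : A = M + - rschur r Z by rewrite eM addrK.
  by rewrite -[X in _ <= _ + X](seminormN hN); case: hN => _ + _; apply.
rewrite mulrBl mul1r.
have -> : n%:R ^+ 2 * ((2 + T) ^+ 2 + 1) * tau ^+ 4 / (1 + be) * N Z =
  n%:R ^+ 2 * ((1 + be)^-1 * (((2 + T) ^+ 2 + 1) * tau ^+ 4)) * N Z by ring.
lra.
Qed.

(** Taking square roots of all [a_i], [b_j] halves the spread [tau] and replaces
[be] by the pair [si], [- si].  The cap [T] on the spread keeps the constant of
the fourth order estimate the same at every depth. *)
Lemma quad_expansive_approx (T : R) m : forall (tau be : R) a b Z,
  -1 < be -> be <= 1 -> 0 <= tau -> tau <= T ->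
  (forall i, 1 <= a i <= 1 + tau) -> (forall j, 1 <= b j <= 1 + tau) ->
  (1 - n%:R ^+ 2 * ((2 + T) ^+ 2 + 1) * tau ^+ 4 / (1 + be) / 4 ^+ m) * N Z
  <= N (rschur (fun i j => quad_ratio be (a i) (b j)) Z).
Proof.
elim: m => [|m IH] tau be a b Z be1 be2 t0 tT ha hb.
  by rewrite expr0 divr1; apply: quad_expansive_near1.
set D := n%:R ^+ 2 * ((2 + T) ^+ 2 + 1) in IH *.
have D0 : 0 <= D by rewrite mulr_ge0 ?sqr_ge0 // addr_ge0 ?sqr_ge0.
pose si := Num.sqrt ((1 - be) / 2).
have si0 : 0 <= si by exact: sqrtr_ge0.
have si2 : si ^+ 2 = (1 - be) / 2 by rewrite sqr_sqrtr //; lra.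
have si1 : si < 1 by nra.
pose sq (x : 'I_n -> R) i := Num.sqrt (x i).
have sq_bd x : (forall i, 1 <= x i <= 1 + tau) ->
    forall i, 1 <= sq x i <= 1 + tau / 2.
  move=> hx i; have /andP[x1 xt] := hx i.
  have e : sq x i ^+ 2 = x i by rewrite sqr_sqrtr //; lra.
  have s0 : 0 <= sq x i by exact: sqrtr_ge0.
  by apply/andP; split; nra.
have eM : rschur (fun i j => quad_ratio be (a i) (b j)) Z =
    rschur (fun i j => quad_ratio si (sq a i) (sq b j))
      (rschur (fun i j => quad_ratio (- si) (sq a i) (sq b j)) Z).
  rewrite -rschurM; apply: eq_rschur => i j.
  have /andP[a1 _] := sq_bd _ ha i; have /andP[b1 _] := sq_bd _ hb j.
  have /andP[a1' _] := ha i; have /andP[b1' _] := hb j.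
  rewrite -(@quad_ratio_double _ be) ?sqr_sqrtr //; try lra.
rewrite eM; set Z' := rschur _ Z.
have h1 := IH (tau / 2) si _ _ Z' ltac:(lra) ltac:(lra) ltac:(lra) ltac:(lra)
  (sq_bd _ ha) (sq_bd _ hb).
have h2 : (1 - D * (tau / 2) ^+ 4 / (1 + - si) / 4 ^+ m) * N Z <= N Z'.
  by apply: IH (sq_bd _ ha) (sq_bd _ hb); lra.
set u := D * (tau / 2) ^+ 4 / (1 + si) / 4 ^+ m in h1.
set v := D * (tau / 2) ^+ 4 / (1 + - si) / 4 ^+ m in h2.
have p4 : 0 < 4 ^+ m :> R by rewrite exprn_gt0 // ltr0n.
have uv : D * tau ^+ 4 / (1 + be) / 4 ^+ m.+1 = u + v.
  rewrite /u /v [4 ^+ m.+1]exprS; apply: error_split => //; first lra.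
  by rewrite subr_gt0 expr_lt1.
have err_ge0 x : 0 <= x -> 0 <= D * (tau / 2) ^+ 4 / x / 4 ^+ m.
  move=> x0; apply: divr_ge0; last exact: ltW.
  by apply: divr_ge0 => //; apply: mulr_ge0 => //; apply: exprn_ge0; lra.
have u0 : 0 <= u by apply: err_ge0; lra.
have v0 : 0 <= v by apply: err_ge0; lra.
(* When the error of the first factor exceeds 1 the bound is trivial. *)
rewrite uv; have [u1|u1] := leP u 1; last first.
  by apply: le_trans (N_ge0 _); rewrite mulr_le0_ge0 //; lra.
apply: le_trans h1.
have : (1 - u) * ((1 - v) * N Z) <= (1 - u) * N Z' by apply: ler_wpM2l => //; lra.
apply: le_trans; rewrite mulrA ler_wpM2r //.
have := mulr_ge0 u0 v0; lra.
Qed.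

(** The multiplier is homogeneous of degree [0] in [(a, b)], so everything can be
scaled into [[1, 1 + T]] before the previous estimate is used at all depths. *)
Lemma quad_expansive (be : R) a b Z : -1 < be -> be <= 1 ->
  (forall i, 0 < a i) -> (forall j, 0 < b j) ->
  N Z <= N (rschur (fun i j => quad_ratio be (a i) (b j)) Z).
Proof.
move=> be1 be2 ha hb.
(* c dominates every 1 / a_i and 1 / b_j, so that c * a_i and c * b_j are >= 1. *)
pose c := 1 + \sum_i (a i)^-1 + \sum_j (b j)^-1.
have sumV x : (forall i : 'I_n, 0 < x i) ->
    forall i, (x i)^-1 <= \sum_i (x i)^-1 :> R.
  move=> hx i; rewrite (bigD1 i) //= lerDl sumr_ge0 // => k _.
  by rewrite invr_ge0 ltW.
have sum0 x : (forall i : 'I_n, 0 < x i) -> 0 <= \sum_i x i :> R.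
  by move=> hx; rewrite sumr_ge0 // => i _; exact: ltW.
have ha' i : 0 < (a i)^-1 by rewrite invr_gt0.
have hb' i : 0 < (b i)^-1 by rewrite invr_gt0.
have sa := sum0 _ ha'; have sb := sum0 _ hb'.
have c0 : 0 < c by rewrite /c; lra.
pose T := \sum_i c * a i + \sum_j c * b j.
have hca i : 0 < c * a i by rewrite mulr_gt0.
have hcb i : 0 < c * b i by rewrite mulr_gt0.
have T0 : 0 <= T by rewrite addr_ge0 ?sum0.
have le_sum x : (forall i : 'I_n, 0 < x i) -> forall i, x i <= \sum_i x i :> R.
  by move=> hx i; rewrite (bigD1 i) //= lerDl sumr_ge0 // => k _; exact: ltW.
have bd_a i : 1 <= c * a i <= 1 + T.
  apply/andP; split; last by rewrite /T; have := le_sum _ hca i; have := sum0 _ hcb; lra.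
  by rewrite -ler_pdivrMr // div1r /c; have := sumV _ ha i; lra.
have bd_b i : 1 <= c * b i <= 1 + T.
  apply/andP; split; last by rewrite /T; have := le_sum _ hcb i; have := sum0 _ hca; lra.
  by rewrite -ler_pdivrMr // div1r /c; have := sumV _ hb i; lra.
have eM : rschur (fun i j => quad_ratio be (a i) (b j)) Z =
    rschur (fun i j => quad_ratio be (c * a i) (c * b j)) Z.
  apply: eq_rschur => i j; rewrite /quad_ratio; field.
  rewrite !(gt_eqF (ha i), gt_eqF (hb j), gt_eqF c0) /=.
  by apply: lt0r_neq0; lra.
rewrite eM; set y := N (rschur _ _).
pose D := n%:R ^+ 2 * ((2 + T) ^+ 2 + 1) * T ^+ 4 / (1 + be).
have approx m : (1 - D / 4 ^+ m) * N Z <= y.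
  exact: quad_expansive_approx.
have D0 : 0 <= D.
  apply: divr_ge0; last lra.
  apply: mulr_ge0; last exact: exprn_ge0.
  by rewrite mulr_ge0 ?sqr_ge0 // addr_ge0 ?sqr_ge0.
have x0 := N_ge0 Z.
rewrite -subr_le0; apply: (@le0_geometric _ 4 _ (D * N Z)) => // m.
have p4 : 0 < 4 ^+ m :> R by rewrite exprn_gt0 // ltr0n.
have := approx m.
by rewrite mulrBl mul1r mulrAC lerBlDl -lerBlDr ler_pdivlMr.
Qed.

(** The condition [s <= 1/2] says exactly that [be = s / (1 - s) <= 1].  Rows and
columns where [a] or [b] vanishes contribute nothing on the left; there [a], [b]
are replaced by [1] and the right-hand side is masked. *)
Lemma geometric_le_heron (s : R) a b Y : 0 <= s <= 1 / 2 ->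
  (forall i, 0 <= a i) -> (forall j, 0 <= b j) ->
  N (rschur (fun i j => a i * b j) Y) <=
  N (rschur (fun i j => s * (a i * b j) + (1 - s) * ((a i ^+ 2 + b j ^+ 2) / 2)) Y).
Proof.
move=> /andP[s0 s1] ha hb; set Z := rschur _ Y; set H := rschur _ Y.
pose fill (x : 'I_n -> R) i := if x i == 0 then 1 else x i.
have fill_gt0 x : (forall i, 0 <= x i) -> forall i, 0 < fill x i.
  by move=> hx i; rewrite /fill; case: eqVneq => // xi; rewrite lt_def xi hx.
pose be := s / (1 - s).
have s1' : 0 < 1 - s by lra.
have be0 : 0 <= be by rewrite divr_ge0 // ltW.
have be1 : be <= 1 by rewrite ler_pdivrMr //; lra.
have := quad_expansive Z (lt_le_trans (ltrN10 _) be0) be1 (fill_gt0 _ ha) (fill_gt0 _ hb).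
move=> /le_trans; apply.
suff -> : rschur (fun i j => quad_ratio be (fill a i) (fill b j)) Z =
    \matrix_(i, j) (if (a i != 0) && (b j != 0) then H i j else 0).
  exact: (seminorm_mask hN (fun i => a i != 0) (fun j => b j != 0) H).
apply/matrixP => i j; rewrite !mxE /fill.
case: eqVneq => [->|ai]; first by rewrite mul0r mul0r mulr0.
case: eqVneq => [->|bj] /=; first by rewrite mulr0 mul0r mulr0.
rewrite mulrA -rmorphM; congr (_%:C * _); rewrite /quad_ratio /be; field.
by rewrite ai bj (gt_eqF s1') subrK oner_eq0.
Qed.

(** [H_s] is a convex combination of [H_s'] and of the geometric mean. *)
Lemma heron_le (s s' : R) (lam mu : 'rV[R]_n) Y :
  s' <= s <= 1 -> 0 <= s' <= 1 / 2 ->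
  (forall i, 0 <= lam 0 i) -> (forall j, 0 <= mu 0 j) ->
  N (rschur (fun i j => heron_mean s (lam 0 i) (mu 0 j)) Y) <=
  N (rschur (fun i j => heron_mean s' (lam 0 i) (mu 0 j)) Y).
Proof.
move=> /andP[ss' s1] hs' hl hm; have /andP[s0' s1'] := hs'.
pose a i := Num.sqrt (lam 0 i); pose b j := Num.sqrt (mu 0 j).
have hE t i j : heron_mean t (lam 0 i) (mu 0 j) =
    t * (a i * b j) + (1 - t) * ((a i ^+ 2 + b j ^+ 2) / 2).
  by rewrite /heron_mean sqrtrM ?sqr_sqrtr.
pose al := (1 - s) / (1 - s').
have s'1 : 0 < 1 - s' by lra.
have al0 : 0 <= al by rewrite divr_ge0 //; lra.
have al1 : al <= 1 by rewrite ler_pdivrMr //; lra.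
set H := rschur _ Y; set H' := rschur _ Y.
pose G := rschur (fun i j => a i * b j) Y.
have leG : N G <= N H'.
  have -> : H' = rschur (fun i j => s' * (a i * b j) +
      (1 - s') * ((a i ^+ 2 + b j ^+ 2) / 2)) Y by apply: eq_rschur => i j.
  by apply: geometric_le_heron => // i; exact: sqrtr_ge0.
have -> : H = al%:C *: H' + (1 - al)%:C *: G.
  apply/matrixP => i j; rewrite !mxE !mulrA -!rmorphM -mulrDl -rmorphD.
  congr (_%:C * _); rewrite !hE /al; field.
  by rewrite gt_eqF.
have tri : N (al%:C *: H' + (1 - al)%:C *: G) <= al * N H' + (1 - al) * N G.
  have [_ Ntri _] := hN; apply: le_trans (Ntri _ _) _.
  by rewrite !(seminorm_rscale hN) !ger0_norm ?subr_ge0.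
apply: (le_trans tri).
have : (1 - al) * N G <= (1 - al) * N H' by rewrite ler_wpM2l // subr_ge0.
lra.
Qed.

End Expansion.

Lemma real_spectrum_ge0 (R : realType) (n : nat) (S : 'M[R[i]]_n) :
  psdmx S -> forall i, 0 <= real_spectrum S 0 i.
Proof.
move=> [hS pS] i; rewrite mxE -[0]/(complex.Re 0).
pose P := spectralmx S.
have uP : P *m P^t* = 1%:M by apply/unitarymxP/spectral_unitarymx.
have e : P *m S *m P^t* = diag_mx (spectral_diag S).
  have h := hermsym_spectral hS; rewrite -/P trmxCK in h.
  by rewrite {1}h !mulmxA uP mul1mx -mulmxA uP mulmx1.
have := pS (col i (P^t*)).
have -> : (col i (P^t*))^t* = row i P.
  by apply/matrixP => k l; rewrite !mxE conjCK.
rewrite -row_mul.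
have -> : (row i (P *m S) *m col i (P^t*)) 0 0 = (P *m S *m P^t*) i i.
  by rewrite !mxE; apply: eq_bigr => k _; rewrite !mxE.
rewrite e mxE eqxx mulr1n lecE => /andP[_]; exact.
Qed.

Lemma heron_op_norm_le (R : realType) (n : nat) (N : 'M[R[i]]_n -> R) (s s' : R)
    (S T X : 'M[R[i]]_n) :
  unitarily_invariant_norm N -> s' <= s <= 1 -> 0 <= s' <= 1 / 2 ->
  psdmx S -> psdmx T ->
  N (heron_op s S T X) <= N (heron_op s' S T X).
Proof.
move=> [_ _ Nz Nt Ni] hs hs' pS pT.
have hN : unitarily_invariant_seminorm N by split.
have unit_spec (A : 'M[R[i]]_n) : (spectralmx A)^t* \is unitarymx.
  by rewrite trmxC_unitary spectral_unitarymx.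
rewrite /heron_op /heron_diag !Ni ?trmxC_unitary ?spectral_unitarymx ?unit_spec //.
have toR t Y : map2_mx *%R (\matrix_(i, j)
      (heron_mean t (real_spectrum S 0 i) (real_spectrum T 0 j))%:C) Y =
    rschur (fun i j => heron_mean t (real_spectrum S 0 i) (real_spectrum T 0 j)) Y.
  by apply/matrixP => i j; rewrite !mxE.
by rewrite !toR; apply: heron_le => //; exact: real_spectrum_ge0.
Qed.

(** * Absolutely monotone functions *)

Section Calculus.
Variable R : realType.
Implicit Types (f df : R -> R) (K : R -> R).

Local Notation is_deriv x f d := (is_derive (x : R) (1 : R) (f : R -> R) (d : R)).

Lemma is_derive_add f g (x a b : R) : is_deriv x f a -> is_deriv x g b ->
  is_deriv x (fun y => f y + g y) (a + b).
Proof. by move=> hf hg; have := is_deriveD hf hg. Qed.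

Lemma is_derive_mul f g (x a b : R) : is_deriv x f a -> is_deriv x g b ->
  is_deriv x (fun y => f y * g y) (a * g x + f x * b).
Proof.
move=> hf hg; have := is_deriveM hf hg.
by rewrite /GRing.scale /= addrC (mulrC (g x)).
Qed.

Lemma is_derive_comp f g (x a b : R) : is_deriv (g x) f a -> is_deriv x g b ->
  is_deriv x (fun y => f (g y)) (a * b).
Proof. by move=> hf hg; have := is_derive1_comp hf hg. Qed.

Lemma is_derive_inv f (x a : R) : f x != 0 -> is_deriv x f a ->
  is_deriv x (fun y => (f y)^-1) (- (f x) ^- 2 * a).
Proof. by move=> fx hf; have := is_deriveV fx hf. Qed.

Lemma is_derive_scale f (c x a : R) : is_deriv x f a ->
  is_deriv x (fun y => c * f y) (c * a).
Proof. by move=> hf; have := is_deriveZ c hf. Qed.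

Lemma is_derive_reflect f (x a : R) : is_deriv (- x) f a ->
  is_deriv x (fun y => f (- y)) (- a).
Proof.
by move=> hf; rewrite -mulrN1; apply: (is_derive_comp hf).
Qed.

Lemma is_derive_addl f (c x a : R) : is_deriv x f a ->
  is_deriv x (fun y => c + f y) a.
Proof.
move=> hf; rewrite -[X in is_derive _ _ _ X]add0r.
by apply: is_derive_add hf; exact: is_derive_cst.
Qed.

Lemma is_derive_translate f (c x a : R) : is_deriv (c + x) f a ->
  is_deriv x (fun y => f (c + y)) a.
Proof.
move=> hf; rewrite -[a]mulr1; apply: (is_derive_comp hf).
by apply: is_derive_addl; apply: is_derive_id.
Qed.

Lemma mean_value f df (a b : R) : (forall x : R, is_deriv x f (df x)) -> a < b ->
  exists c, a < c < b /\ f b - f a = df c * (b - a).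
Proof.
move=> hf ab.
have cf : {within `[a, b]%classic, continuous f}.
  by apply: derivable_within_continuous => x _; apply: ex_derive.
have [c cab e] := MVT ab (fun x _ => hf x) cf.
by exists c; split=> //; move: cab; rewrite in_itv.
Qed.

Lemma derive_ge0_le f df (a b : R) : (forall x : R, is_deriv x f (df x)) -> a <= b ->
  (forall x, a <= x -> 0 <= df x) -> f a <= f b.
Proof.
move=> hf; rewrite le_eqVlt => /predU1P[->//|ab] h.
have [c [/andP[ac _] e]] := mean_value hf ab.
by rewrite -subr_ge0 e mulr_ge0 ?h ?subr_ge0 // ltW.
Qed.

Lemma is_derive_shifted_power (M p : R) k (y : R) :
  is_deriv y (fun y => M * (y - p) ^+ k.+1) (M * (k.+1%:R * (y - p) ^+ k)).
Proof.
pose P : {poly R} := M *: ('X - p%:P) ^+ k.+1.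
have := is_derive_poly P y.
have -> : horner P = (fun y => M * (y - p) ^+ k.+1).
  by apply/funext => z; rewrite hornerZ horner_exp hornerXsubC.
rewrite derivZ deriv_exp derivXsubC mul1r hornerZ hornerMn horner_exp hornerXsubC.
by rewrite mulr_natl.
Qed.

Lemma bin_le_pow2 n k : ('C(n, k) <= 2 ^ n)%N.
Proof.
elim: n k => [|n IH] [|k]; rewrite ?bin0 ?expn_gt0 // binS expnS mul2n -addnn.
exact: leq_add.
Qed.

(** A function on the line whose successive derivatives [F n] grow at most like
[L ^ n n!] and are all nonnegative at [0] has nonnegative derivatives on the
whole half-line. *)
Section AbsolutelyMonotone.
Variables (F : nat -> R -> R) (A L : R).
Hypothesis L0 : 0 < L.
Hypothesis F_derive : forall n (x : R), is_deriv x (F n) (F n.+1 x).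
Hypothesis F_bound : forall n x, `|F n x| <= A * L ^+ n * n`!%:R.

(** Taylor's inequality with the nonnegative terms dropped and only the
remainder kept; it follows by induction on the order [k], since the derivative
of the difference of the two sides is the same difference for [F n.+1] at
order [k - 1]. *)
Lemma taylor_lower p : (forall n, 0 <= F n p) -> forall k n x, p <= x ->
  - (A * L ^+ (n + k) * (n + k)`!%:R / k`!%:R * (x - p) ^+ k) <= F n x.
Proof.
move=> Fp; elim=> [|k IH] n x px.
  rewrite addn0 fact0 divr1 expr0 mulr1.
  by have := F_bound n x; rewrite ler_norml => /andP[].
set M := A * _ * _ / _.
pose H y := F n y + M * (y - p) ^+ k.+1.
pose dH y := F n.+1 y + A * L ^+ (n.+1 + k) * (n.+1 + k)`!%:R / k`!%:R * (y - p) ^+ k.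
have hH (y : R) : is_deriv y H (dH y).
  have -> : dH y = F n.+1 y + M * (k.+1%:R * (y - p) ^+ k).
    rewrite /dH /M addnS -addSn factS natrM; congr (_ + _); field.
    by rewrite pnatr_eq0 -lt0n fact_gt0 addrC natr1 pnatr_eq0.
  exact: is_derive_add (F_derive n y) (is_derive_shifted_power M p k y).
have := derive_ge0_le hH px.
have -> : H p = F n p by rewrite /H subrr expr0n mulr0 addr0.
have dH0 y : p <= y -> 0 <= dH y by move=> py; have := IH n.+1 y py; rewrite /dH; lra.
by move=> /(_ dH0); have := Fp n; rewrite /H; lra.
Qed.

(** Within [1 / (4 L)] the remainder is at most a constant times [2 ^ -k]; this
distance does not depend on the base point, so steps can be chained. *)
Lemma abs_monotone_step p : (forall n, 0 <= F n p) ->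
  forall n x, p <= x <= p + (4 * L)^-1 -> 0 <= F n x.
Proof.
move=> Fp n x /andP[px xp]; rewrite -oppr_le0.
apply: (@le0_geometric _ 2 _ (A * (2 * L) ^+ n * n`!%:R)) => // k.
have h := taylor_lower Fp k n px.
have A0 : 0 <= A.
  by have := F_bound 0 0; rewrite expr0 fact0 !mulr1; apply: le_trans.
have b1 : (x - p) ^+ k <= ((4 * L)^-1) ^+ k.
  rewrite lerXn2r ?nnegrE ?invr_ge0 ?subr_ge0 ?lerBlDl //.
  by rewrite mulr_ge0 // ltW.
have b2 : (n + k)`!%:R / k`!%:R <= n`!%:R * 2 ^+ (n + k) :> R.
  rewrite ler_pdivrMr ?ltr0n ?fact_gt0 //.
  have -> : n`!%:R * 2 ^+ (n + k) * k`!%:R = (2 ^ (n + k) * (n`! * k`!))%:R :> R.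
    by rewrite !natrM natrX; ring.
  rewrite ler_nat -(@bin_fact (n + k) n) ?leq_addr // addKn.
  by rewrite leq_mul2r bin_le_pow2 orbT.
have b3 : A * L ^+ (n + k) * (n + k)`!%:R / k`!%:R * (x - p) ^+ k <=
   A * L ^+ (n + k) * (n`!%:R * 2 ^+ (n + k)) * ((4 * L)^-1) ^+ k.
  rewrite -(mulrA _ _ (k`!%:R^-1)); apply: ler_pM => //.
  - by rewrite !mulr_ge0 ?exprn_ge0 ?invr_ge0 ?ler0n // ltW.
  - by rewrite exprn_ge0 // subr_ge0.
  by rewrite ler_wpM2l // mulr_ge0 // exprn_ge0 // ltW.
have p2 : 0 < 2 ^+ k :> R by rewrite exprn_gt0.
rewrite -ler_pdivlMr //.
apply: le_trans (_ : _ <= A * L ^+ (n + k) * (n`!%:R * 2 ^+ (n + k))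
                          * ((4 * L)^-1) ^+ k) _.
  lra.
rewrite le_eqVlt; apply/orP; left; apply/eqP.
have -> : (4 * L)^-1 = (L * 2 * 2)^-1 by congr (_^-1); ring.
rewrite !exprD exprVn !exprMn; field.
by rewrite !expf_neq0 // ?gt_eqF.
Qed.

Lemma abs_monotone : (forall n, 0 <= F n 0) -> forall n x, 0 <= x -> 0 <= F n x.
Proof.
move=> F0 n x x0; pose h := (4 * L)^-1.
have h0 : 0 < h by rewrite invr_gt0 mulr_gt0.
have reach m : forall n x, 0 <= x <= m%:R * h -> 0 <= F n x.
  elim: m => [|m IH] {n x x0} n x /andP[x0 xm].
    by move: xm; rewrite mul0r => xm; have -> : x = 0 by lra.
  have [xm'|xm'] := leP x (m%:R * h); first by apply: IH; rewrite x0.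
  apply: (@abs_monotone_step (m%:R * h)).
    by move=> i; apply: IH; rewrite lexx andbT mulr_ge0 // ltW.
  rewrite (ltW xm') /= (le_trans xm) // -natr1 -/h; lra.
apply: (reach (Num.bound (x / h))); rewrite x0 /= -ler_pdivrMr //.
by apply/ltW/archi_boundP/divr_ge0 => //; exact: ltW.
Qed.

End AbsolutelyMonotone.

(** Positive definiteness in the sense of Bochner, tested on real weights only. *)
Definition posdef_fun K := forall n (t w : 'I_n -> R),
  0 <= \sum_i \sum_j w i * w j * K (t i - t j).

Lemma posdef_at0 K : posdef_fun K -> 0 <= K 0.
Proof.
by move=> /(_ 1%N (fun=> 0) (fun=> 1)); rewrite !big_ord1 subrr !mul1r.
Qed.

(** Apply the hypothesis to the points [t_i] and [t_i + h] with opposite weights. *)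
Lemma posdef_second_difference K h : posdef_fun K ->
  posdef_fun (fun x => 2 * K x - K (x + h) - K (x - h)).
Proof.
move=> pK n t w.
pose t' i := match split i with inl a => t a | inr b => t b + h end.
pose w' i := match split i with inl a => w a | inr b => - w b end.
have tl i : t' (lshift n i) = t i by rewrite /t' (unsplitK (inl i)).
have tr i : t' (rshift n i) = t i + h by rewrite /t' (unsplitK (inr i)).
have wl i : w' (lshift n i) = w i by rewrite /w' (unsplitK (inl i)).
have wr i : w' (rshift n i) = - w i by rewrite /w' (unsplitK (inr i)).
have := pK (n + n)%N t' w'.
rewrite big_split_ord /= -big_split /=; congr (_ <= _).
apply: eq_bigr => i _; rewrite !big_split_ord /= -!big_split /=.
apply: eq_bigr => j _; rewrite !tl !tr !wl !wr.
have -> : t i + h - (t j + h) = t i - t j by ring.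
have -> : t i - (t j + h) = t i - t j - h by ring.
have -> : t i + h - t j = t i - t j + h by ring.
ring.
Qed.

Lemma pos_of_derive_pos f (d : R) : is_deriv (0 : R) f d -> f 0 = 0 -> 0 < d ->
  exists2 r, 0 < r & forall x, 0 < x < r -> 0 < f x.
Proof.
move=> /is_derive1_caratheodory[g [fg cg g0]] f0 d0.
have : \forall x \near (0 : R), 0 < g x.
  by apply: (@cvgr_gt R R (nbhs (0 : R)) _ g (g 0) cg 0); rewrite g0.
move=> /nbhs_ballP[r /= r0 hr]; exists r => // x /andP[x0 xr].
have := fg x; rewrite f0 !subr0 => ->; apply: mulr_gt0 => //.
by apply: hr; rewrite /ball /= sub0r normrN gtr0_norm.
Qed.

Lemma is_derive_bigsum n (f df : 'I_n -> R -> R) (x : R) :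
  (forall i, is_deriv x (f i) (df i x)) ->
  is_deriv x (fun x => \sum_(i < n) f i x) (\sum_(i < n) df i x).
Proof.
elim: n f df => [|n IH] f df h.
  have -> : (fun y => \sum_(i < 0) f i y) = (fun=> 0).
    by apply/funext => y; rewrite big_ord0.
  by rewrite big_ord0; exact: is_derive_cst.
have -> : (fun y => \sum_(i < n.+1) f i y) =
    (fun y => f ord0 y + \sum_(i < n) f (lift ord0 i) y).
  by apply/funext => y; rewrite big_ord_recl.
rewrite big_ord_recl; apply: is_derive_add (h _) _.
exact: (IH (fun i => f (lift ord0 i)) (fun i => df (lift ord0 i))).
Qed.

(** The second difference quotients of [- K] are positive definite; the limit is
taken inside one fixed quadratic form, whose sum over [h] and [- h] would
otherwise have a strict local minimum at [0], contradicting
[posdef_second_difference]. *)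
Lemma posdef_neg_derive2 K K1 K2 : (forall x : R, is_deriv x K (K1 x)) ->
  (forall x : R, is_deriv x K1 (K2 x)) -> posdef_fun K ->
  posdef_fun (fun x => - K2 x).
Proof.
move=> hK hK1 pK n t w.
pose S (J : R -> R) h := \sum_i \sum_j w i * w j * J (t i - t j + h).
have dS (J J' : R -> R) (h : R) :
    (forall x : R, is_deriv x J (J' x)) -> is_deriv h (S J) (S J' h).
  move=> hJ.
  apply: (@is_derive_bigsum _ (fun i h => \sum_j w i * w j * J (t i - t j + h))
    (fun i h => \sum_j w i * w j * J' (t i - t j + h))) => i.
  apply: (@is_derive_bigsum _ (fun j h => w i * w j * J (t i - t j + h))
    (fun j h => w i * w j * J' (t i - t j + h))) => j.
  exact: is_derive_scale (is_derive_translate (hJ _)).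
have -> : \sum_i \sum_j w i * w j * - K2 (t i - t j) = - S K2 0.
  rewrite -sumrN; apply: eq_bigr => i _; rewrite -sumrN; apply: eq_bigr => j _.
  by rewrite addr0 mulrN.
rewrite oppr_ge0; have [//|S2] := leP (S K2 0) 0.
pose P h := S K h + S K (- h); pose P1 h := S K1 h - S K1 (- h).
have dP (h : R) : is_deriv h P (P1 h).
  by apply: is_derive_add (dS _ _ h hK) _; exact: is_derive_reflect (dS _ _ (- h) hK).
have dP1 : is_deriv (0 : R) P1 (S K2 0 + - - S K2 (- 0)).
  apply: is_derive_add (dS _ _ 0 hK1) _.
  have := is_derive_reflect (dS _ _ (- 0) hK1) => /(is_derive_scale (-1)).
  by rewrite !mulN1r; under eq_fun do rewrite mulN1r.
have [||r r0 hr] := pos_of_derive_pos dP1; first by rewrite /P1 oppr0 subrr.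
  by rewrite oppr0 opprK addr_gt0.
have r20 : 0 < r / 2 by lra.
have [c [/andP[c0 cr]]] := mean_value dP r20.
rewrite subr0 => e.
have P1c : 0 < P1 c by apply: hr; lra.
have : 0 < P (r / 2) - P 0 by rewrite e mulr_gt0.
have := posdef_second_difference (r / 2) pK t w.
have -> : \sum_i \sum_j w i * w j *
    (2 * K (t i - t j) - K (t i - t j + r / 2) - K (t i - t j - r / 2)) =
    P 0 - P (r / 2).
  rewrite /P /S oppr0 -!big_split -sumrB; apply: eq_bigr => i _.
  rewrite -!big_split -sumrB; apply: eq_bigr => j _ /=; rewrite addr0; ring.
lra.
Qed.

End Calculus.

(** * The function 1 / (be + cosh t) for be > 1 *)

Section Obstruction.
Variable R : realType.
Implicit Types (P Q : {poly R}) (K f : R -> R).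

Local Notation is_deriv x f d := (is_derive (x : R) (1 : R) (f : R -> R) (d : R)).

(** Majorant series: they bound all the polynomials [jet j] on an interval [[- M, M]]. *)
Definition dominated P Q := forall i, `|P`_i| <= Q`_i.

Lemma dominatedD P1 P2 Q1 Q2 : dominated P1 Q1 -> dominated P2 Q2 ->
  dominated (P1 + P2) (Q1 + Q2).
Proof.
move=> h1 h2 i; rewrite !coefD (le_trans (ler_normD _ _)) //; exact: lerD.
Qed.

Lemma dominatedM P1 P2 Q1 Q2 : dominated P1 Q1 -> dominated P2 Q2 ->
  dominated (P1 * P2) (Q1 * Q2).
Proof.
move=> h1 h2 i; rewrite !coefM (le_trans (ler_norm_sum _ _ _)) //.
by apply: ler_sum => j _; rewrite normrM ler_pM.
Qed.

Lemma dominated_deriv P Q : dominated P Q -> dominated P^`() Q^`().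
Proof. by move=> h i; rewrite !coef_deriv normrMn lerMn2r h orbT. Qed.

Lemma dominated_horner P Q (M x : R) : dominated P Q -> `|x| <= M ->
  `|P.[x]| <= Q.[M].
Proof.
move=> h xM; set m := maxn (size P) (size Q).
rewrite (horner_coef_wide _ (leq_maxl _ _ : (size P <= m)%N)).
rewrite (horner_coef_wide _ (leq_maxr _ _ : (size Q <= m)%N)).
apply: le_trans (ler_norm_sum _ _ _) _; apply: ler_sum => i _.
by rewrite normrM normrX ler_pM ?exprn_ge0 // lerXn2r // nnegrE (le_trans _ xM).
Qed.

Variable be : R.
Hypothesis be1 : 1 < be.

(** The polynomial [G] with [f'^2 = G (f)] for [f = 1 / (be + cos x)], and
[k'^2 = - G (k)] for [k = 1 / (be + cosh t)].  The opposite signs record that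
the two functions are continuations of each other along [t = i x]. *)
Definition quartic : {poly R} :=
  (1 - be ^+ 2) *: 'X^4 + (2 * be) *: 'X^3 - 'X^2.

(** If [f'^2 = G (f)], then [f'' = G' (f) / 2], and the second derivative of
[Q (f)] is [flow Q (f)]. *)
Definition flow Q := quartic * Q^`()^`() + (2^-1 *: quartic^`()) * Q^`().

Definition jet j := iter j flow 'X.

Lemma horner_quartic x : quartic.[x] =
  (1 - be ^+ 2) * x ^+ 4 + 2 * be * x ^+ 3 - x ^+ 2.
Proof. by rewrite /quartic !hornerE. Qed.

Lemma horner_half_quartic x : (2^-1 *: quartic^`()).[x] =
  2 * (1 - be ^+ 2) * x ^+ 3 + 3 * be * x ^+ 2 - x.
Proof. by rewrite /quartic !poly.derivE !hornerE /=; field. Qed.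

(** The sign [e] is [1] on the circular side and [-1] on the hyperbolic side.
Even derivatives of both functions are thus the same polynomials, up to sign. *)
Lemma jet_derive (e : R) f f1 :
  (forall x, is_deriv x f (f1 x)) ->
  (forall x, is_deriv x f1 (e * (2^-1 *: quartic^`()).[f x])) ->
  (forall x, f1 x ^+ 2 = e * quartic.[f x]) ->
  forall Q x, is_deriv x (fun y => Q.[f y]) (Q^`().[f x] * f1 x) /\
              is_deriv x (fun y => Q^`().[f y] * f1 y) (e * (flow Q).[f x]).
Proof.
move=> hf hf1 f1E.
have first Q x : is_deriv x (fun y => Q.[f y]) (Q^`().[f x] * f1 x).
  exact: (is_derive_comp (is_derive_poly Q (f x)) (hf x)).
move=> Q x; split=> //.
have -> : e * (flow Q).[f x] = Q^`()^`().[f x] * f1 x * f1 x +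
    Q^`().[f x] * (e * (2^-1 *: quartic^`()).[f x]).
  rewrite /flow hornerD !hornerM -[_ * f1 x * _]mulrA -expr2 f1E; ring.
exact: is_derive_mul.
Qed.

(** Majorants of this shape reproduce themselves: with [G] dominated by
[g (1 + X)^4], one step multiplies the constant by
[g ((2j + 1) (2j) + 2 (2j + 1)) = g (2j + 1) (2j + 2)]. *)
Lemma jet_dominated j :
  dominated (jet j) (((1 + be ^+ 2) ^+ j * (j.*2)`!%:R) *: (1 + 'X) ^+ (j.*2).+1).
Proof.
set g := 1 + be ^+ 2; have be1' := be1.
have b2 : 1 <= be ^+ 2 by rewrite expr_ge1 // ltW // (lt_trans ltr01).
have domG : dominated quartic (g *: (1 + 'X) ^+ 4).
  move=> i; rewrite /quartic addrC.
  rewrite !(coefD, coefN, coefZ, coefXn).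
  have -> : (1 + 'X : {poly R}) ^+ 4 = 'X^4 + 4 *: 'X^3 + 6 *: 'X^2 + 4 *: 'X + 1.
    by rewrite -!mul_polyC; ring.
  rewrite !(coefD, coefN, coefZ, coefXn, coefX, coef1).
  have hb : `|2 * be| <= g * 4.
    by rewrite ger0_norm /g; [have := sqr_ge0 (be - 1); rewrite sqrrB; lra | lra].
  have hc : `|1 - be ^+ 2| <= g by rewrite ler0_norm /g; lra.
  case: i => [|[|[|[|[|i]]]]]; rewrite /=
    ?(mulr0, mulr1, addr0, add0r, oppr0, subr0, normr0, normrN, normr1) //;
    rewrite /g; lra.
have dom1 : dominated 'X (1 + 'X).
  by move=> i; rewrite coefD coef1 coefX; case: i => [|[|i]] /=;
    rewrite ?normr0 ?normr1 ?addr0 ?add0r ?ler01.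
elim: j => [|j IH]; first by rewrite expr0 mul1r scale1r expr1.
rewrite /jet iterS -/(jet j); set c := _ * _ in IH.
have der k : ((1 + 'X : {poly R}) ^+ k.+1)^`() = k.+1%:R *: (1 + 'X) ^+ k.
  by rewrite deriv_exp derivD derivX derivC add0r mul1r scaler_nat.
have d1 := dominated_deriv IH; have d2 := dominated_deriv d1.
have dG := dominated_deriv domG.
rewrite !derivZ !der !derivZ in d1 d2 dG.
have dG2 : dominated (2^-1 *: quartic^`()) (2^-1 *: (g *: (4 *: (1 + 'X) ^+ 3))).
  move=> i; rewrite coefZ normrM ger0_norm ?invr_ge0 // [leRHS]coefZ.
  by rewrite ler_wpM2l ?invr_ge0.
have := dominatedD (dominatedM domG d2) (dominatedM dG2 d1).
congr (dominated _ _).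
set u := ((1 + 'X) ^+ j.*2)^`().
have hu : (1 + 'X) * u = (j.*2)%:R%:P * (1 + 'X) ^+ j.*2.
  rewrite mul_polyC /u; case: (j.*2) => [|k]; first by rewrite expr0 derivC mulr0 scale0r.
  by rewrite der -scalerAr -exprS.
have -> : g *: (1 + 'X) ^+ 4 * (c *: ((j.*2).+1%:R *: u)) =
    (g * c * (j.*2).+1%:R)%:P * (1 + 'X) ^+ 3 * ((1 + 'X) * u).
  by rewrite -!mul_polyC !polyCM; ring.
rewrite hu doubleS !factS !natrM -!mul_polyC.
have -> : (2^-1)%:P * (g%:P * (4%:P * (1 + 'X) ^+ 3)) *
    (c%:P * ((j.*2).+1%:R%:P * (1 + 'X) ^+ j.*2)) =
    (2^-1 * g * 4 * c * (j.*2).+1%:R)%:P * (1 + 'X) ^+ 3 * (1 + 'X) ^+ j.*2.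
  by rewrite !polyCM; ring.
have -> : (1 + 'X : {poly R}) ^+ (j.*2).+3 = (1 + 'X) ^+ 3 * (1 + 'X) ^+ j.*2.
  by rewrite -exprD.
transitivity ((g * c * (j.*2).+1%:R * (j.*2)%:R + 2^-1 * g * 4 * c * (j.*2).+1%:R)%:P
  * ((1 + 'X) ^+ 3 * (1 + 'X) ^+ j.*2)); first by rewrite !(polyCD, polyCM); ring.
by congr (_%:P * _); rewrite /c exprS -!natr1; field.
Qed.

Definition cosh (t : R) : R := (expR t + expR (- t)) / 2.
Definition sinh (t : R) : R := (expR t - expR (- t)) / 2.

Lemma is_derive_cosh t : is_deriv t cosh (sinh t).
Proof.
rewrite /sinh mulrC; have -> : cosh = (fun t => 2^-1 * (expR t + expR (- t))).
  by apply/funext => x; rewrite mulrC.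
apply: is_derive_scale; apply: is_derive_add.
exact: is_derive_reflect (is_derive_expR _).
Qed.

Lemma is_derive_sinh t : is_deriv t sinh (cosh t).
Proof.
have -> : cosh t = 2^-1 * (expR t + -1 * - expR (- t)) by rewrite mulrC mulN1r opprK.
have -> : sinh = (fun t => 2^-1 * (expR t + -1 * expR (- t))).
  by apply/funext => x; rewrite mulrC mulN1r.
apply: is_derive_scale; apply: is_derive_add; apply: is_derive_scale.
exact: is_derive_reflect (is_derive_expR _).
Qed.

Lemma sinh2 t : sinh t ^+ 2 = cosh t ^+ 2 - 1.
Proof.
have e : expR t * expR (- t) = 1 by rewrite -expRD subrr expR0.
have -> : sinh t ^+ 2 = cosh t ^+ 2 - expR t * expR (- t).
  by rewrite /sinh /cosh; field.
by rewrite e.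
Qed.

Lemma cosh0 : cosh 0 = 1.
Proof. by rewrite /cosh oppr0 expR0; field. Qed.

Lemma cosh_gt0 t : 0 < cosh t.
Proof. by rewrite divr_gt0 // addr_gt0 ?expR_gt0. Qed.

Let k t := (be + cosh t)^-1.

(** The functions [jet j.+1 (k t)] are the successive [- K''], up to the factor
[c1], and the first differentiation removes the constant [c0]; both functions
[1 / (be + cosh t)] and [1 / (be + cos x)] take the value [1 / (be + 1)] at [0]. *)
Lemma jet_ge0 (c0 c1 : R) : 0 < c1 -> posdef_fun (fun t => c0 + c1 * k t) ->
  forall j, 0 <= (jet j).[(be + 1)^-1].
Proof.
move=> c1_gt0 pK; have be1' := be1.
have den t : 0 < be + cosh t by have := cosh_gt0 t; lra.
pose k1 t := -1 * (k t * k t * sinh t).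
have dk t : is_deriv t k (k1 t).
  have := @is_derive_inv _ (fun y => be + cosh y) t _ (lt0r_neq0 (den t))
    (is_derive_addl be (is_derive_cosh t)).
  by congr (is_derive _ _ _ _); rewrite /k1 /k -exprVn; ring.
have dk1 t : is_deriv t k1 (-1 * (2^-1 *: quartic^`()).[k t]).
  rewrite horner_half_quartic.
  have -> : -1 * (2 * (1 - be ^+ 2) * k t ^+ 3 + 3 * be * k t ^+ 2 - k t) =
    -1 * ((k1 t * k t + k t * k1 t) * sinh t + k t * k t * cosh t).
    rewrite /k1.
    transitivity (2 * k t ^+ 3 * sinh t ^+ 2 - k t ^+ 2 * cosh t); last by ring.
    by rewrite sinh2 /k; field; rewrite gt_eqF.
  apply: is_derive_scale; apply: is_derive_mul (is_derive_sinh t).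
  exact: is_derive_mul.
have k1E t : k1 t ^+ 2 = -1 * quartic.[k t].
  rewrite horner_quartic /k1; transitivity (k t ^+ 4 * sinh t ^+ 2); first by ring.
  by rewrite sinh2 /k; field; rewrite gt_eqF.
have dj := jet_derive dk dk1 k1E.
have pj j : posdef_fun (fun t => (jet j.+1).[k t]).
  elim: j => [|j IH].
    have d1 t : is_deriv t (fun t => c0 + c1 * k t) (c1 * k1 t).
      by apply: is_derive_addl; exact: is_derive_scale.
    have d2 t : is_deriv t (fun t => c1 * k1 t) (c1 * (-1 * (2^-1 *: quartic^`()).[k t])).
      exact: is_derive_scale.
    move=> n t w; have := posdef_neg_derive2 d1 d2 pK t w.
    suff -> : \sum_i \sum_j w i * w j *
        - (c1 * (-1 * (2^-1 *: quartic^`()).[k (t i - t j)])) =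
        c1 * \sum_i \sum_j w i * w j * (jet 1).[k (t i - t j)] by rewrite pmulr_rge0.
    rewrite mulr_sumr; apply: eq_bigr => i _; rewrite mulr_sumr; apply: eq_bigr => j _.
    by rewrite /jet /= /flow derivX derivC mulr0 mulr1 add0r; ring.
  have := posdef_neg_derive2 (fun x => (dj (jet j.+1) x).1)
    (fun x => (dj (jet j.+1) x).2) IH.
  congr posdef_fun; apply/funext => t.
  by rewrite mulN1r opprK.
case=> [|j].
  by rewrite /jet /= hornerX invr_ge0; lra.
have := posdef_at0 (pj j); rewrite /k cosh0; exact.
Qed.

(** All derivatives of [1 / (be + cos x)] at [0] are nonnegative: the even ones by
[jet_ge0], while the odd ones contain the factor [sin 0].  Since [be > 1] the
function is bounded on the line, so [abs_monotone] applies, and it contradicts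
the sign of the first derivative at [3 pi / 2]. *)
Lemma not_posdef (c0 c1 : R) : 0 < c1 -> ~ posdef_fun (fun t => c0 + c1 * k t).
Proof.
move=> c1_gt0 /(jet_ge0 c1_gt0) pj; have be1' := be1.
pose f x := (be + cos x)^-1; pose f1 x := f x * f x * sin x.
have den x : be - 1 <= be + cos x by rewrite lerD2l cos_geN1.
have den0 x : 0 < be + cos x by have := den x; lra.
have df x : is_deriv x f (f1 x).
  have := @is_derive_inv _ (fun y => be + cos y) x _ (lt0r_neq0 (den0 x))
    (is_derive_addl be (is_derive_cos x)).
  by congr (is_derive _ _ _ _); rewrite /f1 /f -exprVn; ring.
have df1 x : is_deriv x f1 (1 * (2^-1 *: quartic^`()).[f x]).
  rewrite horner_half_quartic.
  have -> : 1 * (2 * (1 - be ^+ 2) * f x ^+ 3 + 3 * be * f x ^+ 2 - f x) =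
     (f1 x * f x + f x * f1 x) * sin x + f x * f x * cos x.
    rewrite /f1.
    transitivity (2 * f x ^+ 3 * sin x ^+ 2 + f x ^+ 2 * cos x); last by ring.
    by rewrite sin2cos2 /f; field; rewrite gt_eqF.
  by apply: is_derive_mul; exact: is_derive_mul.
have f1E x : f1 x ^+ 2 = 1 * quartic.[f x].
  rewrite horner_quartic /f1; transitivity (f x ^+ 4 * sin x ^+ 2); first by ring.
  by rewrite sin2cos2 /f; field; rewrite gt_eqF.
have dj := jet_derive df df1 f1E.
pose F n x := if odd n then (jet n./2)^`().[f x] * f1 x else (jet n./2).[f x].
have parity n : exists j, n = j.*2 \/ n = j.*2.+1.
  exists n./2; rewrite -[n in n = _ \/ _]odd_double_half
    -[n in _ \/ n = _]odd_double_half.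
  by case: (odd n); [right|left].
have Fe j x : F j.*2 x = (jet j).[f x] by rewrite /F odd_double doubleK.
have Fo j x : F j.*2.+1 x = (jet j)^`().[f x] * f1 x.
  by rewrite /F /= odd_double uphalf_double.
have FeE j : F j.*2 = fun x => (jet j).[f x] by apply/funext => x; exact: Fe.
have FoE j : F j.*2.+1 = fun x => (jet j)^`().[f x] * f1 x.
  by apply/funext => x; exact: Fo.
have F_derive n x : is_deriv x (F n) (F n.+1 x).
  have [j [->|->]] := parity n.
    by rewrite FeE Fo; exact: (dj _ x).1.
  by rewrite -doubleS FoE Fe -[X in is_derive _ _ _ X]mul1r; exact: (dj _ x).2.
pose M := (be - 1)^-1; pose g := 1 + be ^+ 2.
have M0 : 0 < M by rewrite invr_gt0; lra.
have fM x : `|f x| <= M.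
  by rewrite /f /M ger0_norm ?invr_ge0 ?(ltW (den0 x)) // lef_pV2 ?posrE //; lra.
have f1M x : `|f1 x| <= M ^+ 2.
  rewrite !normrM -[M ^+ 2]mulr1 expr2; apply: ler_pM => //; rewrite ?mulr_ge0 //.
    by apply: ler_pM.
  by rewrite ler_norml sin_geN1 sin_le1.
have g1 : 1 <= g by rewrite lerDl sqr_ge0.
(* g (1 + M) absorbs the majorants of the jets, 1 + M ^ 2 the bound of f1. *)
pose A := (1 + M) * (1 + M ^+ 2); pose L := g * (1 + M).
have L1 : 1 <= L by rewrite mulr_ege1 //; lra.
have MA : 1 + M <= A by rewrite ler_peMr ?lerDl ?sqr_ge0 //; lra.
have MA2 : M ^+ 2 <= A by have := sqr_ge0 M; rewrite /A; nra.
have L_ge j : g ^+ j * (1 + M) ^+ j.*2 <= L ^+ j.*2.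
  rewrite exprMn ler_wpM2r ?exprn_ge0 //; first lra.
  by apply: ler_weXn2l => //; rewrite -addnn leq_addr.
have M1 : 0 <= 1 + M by lra.
have gM0 j : 0 <= g ^+ j * (1 + M) ^+ j.*2.
  by rewrite mulr_ge0 ?exprn_ge0 // (le_trans ler01).
have F_bound n x : `|F n x| <= A * L ^+ n * n`!%:R.
  have [j [->|->]] := parity n.
    rewrite Fe; apply: le_trans (dominated_horner (jet_dominated j) (fM x)) _.
    rewrite hornerZ horner_exp !hornerE -/g exprS.
    have -> : g ^+ j * (j.*2)`!%:R * ((1 + M) * (1 + M) ^+ j.*2) =
      (1 + M) * (g ^+ j * (1 + M) ^+ j.*2) * (j.*2)`!%:R by ring.
    by apply: ler_wpM2r => //; apply: ler_pM.
  rewrite Fo normrM.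
  have := dominated_horner (dominated_deriv (jet_dominated j)) (fM x).
  rewrite derivZ deriv_exp derivD derivX derivC add0r mul1r.
  rewrite hornerZ hornerMn horner_exp !hornerE /= -/g => h.
  apply: (@le_trans _ _ (g ^+ j * (j.*2)`!%:R * ((1 + M) ^+ j.*2 *+ (j.*2).+1) * M ^+ 2)).
    by apply: ler_pM.
  rewrite factS natrM -[(1 + M) ^+ _ *+ _]mulr_natl [L ^+ _.+1]exprS.
  have -> : g ^+ j * (j.*2)`!%:R * ((j.*2).+1%:R * (1 + M) ^+ j.*2) * M ^+ 2 =
    M ^+ 2 * (g ^+ j * (1 + M) ^+ j.*2) * ((j.*2).+1%:R * (j.*2)`!%:R) by ring.
  apply: ler_wpM2r; first exact: mulr_ge0.
  apply: ler_pM => //; first exact: sqr_ge0.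
  apply: le_trans (L_ge j) _.
  by rewrite ler_peMl // exprn_ge0 // (le_trans ler01).
have L0 : 0 < L by lra.
have F0 n : 0 <= F n 0.
  have [j [->|->]] := parity n; first by rewrite Fe /f cos0.
  by rewrite Fo /f1 sin0 !mulr0.
have := abs_monotone L0 F_derive F_bound F0 1 (_ : 0 <= pi / 2 + pi).
rewrite (Fo 0%N) /jet /= derivX hornerC mul1r /f1.
have -> : sin (pi / 2 + pi) = -1 :> R by rewrite sinDpi sin_pihalf.
move=> h; have := h ltac:(by rewrite addr_ge0 ?divr_ge0 ?pi_ge0).
have := mulr_gt0 (_ : 0 < f (pi / 2 + pi)) (_ : 0 < f (pi / 2 + pi)).
have f0 : 0 < f (pi / 2 + pi) by rewrite invr_gt0.
move=> /(_ f0 f0); lra.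
Qed.

End Obstruction.

(** * The trace norm *)

Section TraceNorm.
Variables (R : realType) (n : nat).
Local Notation C := R[i].
Implicit Types (A B U V : 'M[C]_n).

Lemma norm_normc z : `|z| = (normc z)%:C :> C.
Proof. by []. Qed.

(** Dual description of the sum of the singular values: it makes unitary
invariance and the lower bounds by test unitaries immediate. *)
Definition trace_values A : set R :=
  [set r | exists2 U, U \is unitarymx & r = normc (\tr (U *m A))].

Definition trace_norm A : R := sup (trace_values A).

Lemma unitarymx1 : (1%:M : 'M[C]_n) \is unitarymx.
Proof. by apply/unitarymxP; rewrite mul1mx trmx1 map_mx1. Qed.

Lemma unitary_entry_le1 U i j : U \is unitarymx -> normc (U i j) <= 1.
Proof.
move=> /unitarymxP/matrixP/(_ i i); rewrite !mxE eqxx => e.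
have h : `|U i j| ^+ 2 <= 1.
  have <- : \sum_k `|U i k| ^+ 2 = 1 :> C.
    by rewrite -[RHS]e; apply: eq_bigr => k _; rewrite !mxE normCK.
  by rewrite (bigD1 j) //= lerDl sumr_ge0 // => k _; rewrite exprn_ge0.
by rewrite -lecR -norm_normc; rewrite expr_le1 in h.
Qed.

Lemma normc_sum (I : Type) (r : seq I) (F : I -> C) :
  normc (\sum_(i <- r) F i) <= \sum_(i <- r) normc (F i).
Proof.
rewrite -lecR rmorph_sum -norm_normc; exact: ler_norm_sum.
Qed.

Lemma trace_values_bounded A : has_sup (trace_values A).
Proof.
split; first by exists (normc (\tr (1%:M *m A))); exists 1%:M; rewrite ?unitarymx1.
exists (\sum_i \sum_j normc (A j i)) => _ [U uU ->].
apply: le_trans (normc_sum _ _) _; apply: ler_sum => i _.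
rewrite mxE; apply: le_trans (normc_sum _ _) _; apply: ler_sum => j _.
rewrite normcM ler_piMl ?unitary_entry_le1 //.
by rewrite -(ler0c (normc _)) -norm_normc.
Qed.

Lemma trace_norm_ge U A : U \is unitarymx -> normc (\tr (U *m A)) <= trace_norm A.
Proof.
by move=> uU; apply: (ub_le_sup (trace_values_bounded A).2); exists U.
Qed.

Lemma trace_norm_le A b :
  (forall U, U \is unitarymx -> normc (\tr (U *m A)) <= b) -> trace_norm A <= b.
Proof.
move=> h; apply: ge_sup; first exact: (trace_values_bounded A).1.
by move=> _ [U uU ->]; exact: h.
Qed.

Lemma trace_norm_seminorm : unitarily_invariant_seminorm trace_norm.
Proof.
have normc_ge0 (z : C) : 0 <= normc z by rewrite -(ler0c (normc _)) -norm_normc.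
have le_scale c A : trace_norm (c *: A) <= normc c * trace_norm A.
  apply: trace_norm_le => U uU; rewrite -scalemxAr linearZ normcM.
  by rewrite ler_wpM2l // trace_norm_ge.
have le_inv U A V : U \is unitarymx -> V \is unitarymx ->
    trace_norm (U *m A *m V) <= trace_norm A.
  move=> uU uV; apply: trace_norm_le => W uW.
  rewrite mulmxA mxtrace_mulC !mulmxA; apply: trace_norm_ge.
  exact: mul_unitarymx (mul_unitarymx uV uW) uU.
split=> [c A | A B | U A V uU uV].
- apply/eqP; rewrite eq_le le_scale /=.
  have [->|c0] := eqVneq c 0.
    rewrite normc0 mul0r; apply: le_trans (trace_norm_ge _ unitarymx1); exact: normc_ge0.
  have := le_scale c^-1 (c *: A); rewrite scalerA mulVf // scale1r normcV.
  have n0 : 0 < normc c.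
    by rewrite lt_def normc_ge0 andbT; apply: contra c0 => /eqP/eq0_normc/eqP.
  by rewrite mulrC ler_pdivlMr // mulrC.
- apply: trace_norm_le => U uU; rewrite mulmxDr linearD.
  by apply: le_trans (le_normcD _ _) _; rewrite lerD // trace_norm_ge.
apply: le_anti; apply/andP; split; first exact: le_inv.
have := le_inv (U^t*) (U *m A *m V) (V^t*); rewrite !trmxC_unitary => /(_ uU uV).
rewrite !mulmxA unitarymx_mulVmx // mul1mx -mulmxA.
by have /unitarymxP -> := uV; rewrite mulmx1.
Qed.

(** Definiteness: by [seminorm_mask] each single entry of a matrix of norm zero
has norm zero, and a transposition matrix moves it to the diagonal. *)
Lemma trace_norm_norm : unitarily_invariant_norm trace_norm.
Proof.
have hN := trace_norm_seminorm; have [Nz Nt Ni] := hN.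
split=> //; first exact: (seminorm_ge0 hN).
move=> A A0; apply/matrixP => i j; rewrite mxE.
pose E := \matrix_(k, l) (if (k == i) && (l == j) then A k l else 0).
have E0 : trace_norm E <= 0 by rewrite -A0; exact: (seminorm_mask hN (pred1 i) (pred1 j)).
have uP : (tperm_mx i j : 'M[C]_n) \is unitarymx.
  apply/unitarymxP; rewrite tr_perm_mx map_perm_mx -perm_mxM.
  by rewrite mulgV perm_mx1.
have := le_trans (trace_norm_ge E uP) E0.
have -> : \tr (tperm_mx i j *m E) = A i j.
  rewrite /tperm_mx -row_permE /mxtrace (bigD1 j) //= !mxE tpermR !eqxx big1 ?addr0 //.
  by move=> k kj; rewrite !mxE (negPf kj) andbF.
move=> h; apply: eq0_normc; apply/eqP; rewrite eq_le h /=.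
by rewrite -(ler0c (normc _)) -norm_normc.
Qed.

(** Summing [2 |r_i| <= 1 + |r_i|^2] over the entries [r_i] of [U e], where
[e] is the all-ones vector, as [U e] has the same length as [e]. *)
Lemma trace_norm_ones : trace_norm (const_mx 1) <= n%:R.
Proof.
apply: trace_norm_le => U uU.
pose e : 'cV[C]_n := const_mx 1; pose r i := (U *m e) i 0.
have -> : \tr (U *m const_mx 1) = \sum_i r i.
  rewrite /mxtrace; apply: eq_bigr => i _; rewrite /r !mxE.
  by apply: eq_bigr => j _; rewrite !mxE.
have r2 : \sum_i `|r i| ^+ 2 = n%:R.
  have : ((U *m e)^t* *m (U *m e)) 0 0 = n%:R.
    rewrite trmx_mul map_mxM mulmxA -(mulmxA (e^t*)) unitarymx_mulVmx // mulmx1.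
    rewrite mxE (eq_bigr (fun=> 1)) ?sumr_const ?card_ord // => i _.
    by rewrite !mxE rmorph1 mulr1.
  by move=> <-; rewrite mxE; apply: eq_bigr => i _; rewrite normCKC /r !mxE.
rewrite -lecR -norm_normc rmorph_nat; apply: le_trans (ler_norm_sum _ _ _) _.
have : \sum_i `|r i| *+ 2 <= \sum_i (1 + `|r i| ^+ 2).
  apply: ler_sum => i _; rewrite -subr_ge0.
  have -> : 1 + `|r i| ^+ 2 - `|r i| *+ 2 = (1 - `|r i|) ^+ 2 by ring.
  by rewrite real_exprn_even_ge0 // rpredB // ?normr_real ?rpred1.
by rewrite sumrMnl [leRHS]big_split /= r2 sumr_const card_ord -mulr2n lerMn2r.
Qed.

(** Lower bound obtained from the Householder reflection [1 - (2 / q) w w^T]. *)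
Lemma trace_norm_reflection (w : 'I_n -> R) (a : 'I_n -> 'I_n -> R) :
  let q := \sum_i w i ^+ 2 in 0 < q ->
  \sum_i a i i - 2 / q * \sum_i \sum_j w i * w j * a j i <=
    trace_norm (\matrix_(i, j) (a i j)%:C).
Proof.
move=> q q0; set A := \matrix_(_, _) _.
pose W : 'M[C]_n := \matrix_(i, j) (w i * w j)%:C.
pose c := (2 / q)%:C; pose U := 1%:M - c *: W.
have WW : W *m W = q%:C *: W.
  apply/matrixP => i j; rewrite !mxE -rmorphM /q mulr_suml rmorph_sum.
  by apply: eq_bigr => k _; rewrite !mxE -rmorphM; congr (_%:C); ring.
have UE i j : U i j = ((i == j)%:R - 2 / q * (w i * w j))%:C.
  rewrite !mxE [in RHS]rmorphB [in RHS]rmorphM; congr (_ - _).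
  by case: (i == j); rewrite ?rmorph1 ?rmorph0.
have UU : U^t* = U.
  apply/matrixP => i j; rewrite mxE mxE !UE conj_conjc conjc_real.
  by rewrite eq_sym (mulrC (w j)).
have uU : U \is unitarymx.
  apply/unitarymxP; rewrite UU /U mulmxBr mulmx1 mulmxBl mul1mx.
  rewrite -scalemxAl -scalemxAr WW !scalerA.
  have -> : c * c * q%:C = c + c.
    by rewrite /c -!rmorphM -rmorphD; congr (_%:C); field; rewrite gt_eqF.
  by rewrite scalerDl opprB addrK subrK.
have := trace_norm_ge A uU; apply: le_trans.
rewrite -lecR -norm_normc.
have -> : \tr (U *m A) = (\sum_i a i i - 2 / q * \sum_i \sum_j w i * w j * a j i)%:C.
  rewrite /U mulmxBl mul1mx -scalemxAl linearB linearZ /= rmorphB rmorphM.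
  rewrite rmorph_sum; congr (_ - _ * _); first by apply: eq_bigr => i _; rewrite mxE.
  rewrite rmorph_sum; apply: eq_bigr => i _; rewrite mxE rmorph_sum.
  by apply: eq_bigr => j _; rewrite !mxE -rmorphM.
by rewrite norm_normc lecR normc_real ler_norm.
Qed.

End TraceNorm.

(** * Necessity of the conditions on the parameters *)

Section Necessity.
Variable R : realType.
Implicit Types (s t : R).

Lemma psdmx_diag n (lam : 'rV[R]_n) : (forall i, 0 <= lam 0 i) ->
  psdmx (diag_mx (map_mx (real_complex R) lam)).
Proof.
move=> lam0; split.
  have := @real_diag_hermsym R[i] n 1%:M (map_mx (real_complex R) lam).
  rewrite mul1mx trmx1 map_mx1 mulmx1; apply.
  by apply/mxOverP => i j; rewrite mxE; apply/complex_realP; exists (lam i j).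
move=> x; rewrite mul_mx_diag mxE sumr_ge0 // => i _; rewrite !mxE.
by rewrite mulrAC -normCKC mulr_ge0 ?exprn_ge0 // ler0c.

Qed.

Definition mean_quotient s s' t : R :=
  (s + (1 - s) * cosh t) / (s' + (1 - s') * cosh t).

Lemma heron_mean_exp s (x y : R) :
  heron_mean s (expR (2 * x)) (expR (2 * y)) =
  expR (x + y) * (s + (1 - s) * cosh (x - y)).
Proof.
have e2 z : expR (2 * z) = expR z ^+ 2 by rewrite expRM_natl.
rewrite /heron_mean !e2 -exprMn -expRD sqrtr_sqr ger0_norm ?expR_ge0 //.
have -> : (expR x ^+ 2 + expR y ^+ 2) / 2 = expR (x + y) * cosh (x - y).
  rewrite /cosh mulrA mulrDr -!expRD -!expRM_natl; congr ((expR _ + expR _) / 2); ring.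
ring.
Qed.

Lemma heron_den_gt0 s t : 0 <= s <= 1 -> 0 < s + (1 - s) * cosh t.
Proof.
move=> /andP[s0 s1]; have c0 := cosh_gt0 t.
have [->|s1'] := eqVneq s 1; first by rewrite subrr mul0r addr0.
have : 0 < (1 - s) * cosh t by rewrite mulr_gt0 // subr_gt0 lt_def eq_sym s1' s1.
lra.
Qed.

(** Eigenvalues [exp (2 t_i)] make the quotient of means depend on [t_i - t_j].
The image of [X] under [H_s'] is the all-ones matrix, of norm at most [n], and
[n] is also the trace of its image under [H_s]: a reflection along a vector [w]
with a negative quadratic form would exceed it. *)
Lemma contractive_posdef s s' : 0 <= s' <= 1 ->
  (forall (n : nat) (N : 'M[R[i]]_n -> R), unitarily_invariant_norm N ->
     forall S T X : 'M[R[i]]_n, psdmx S -> psdmx T ->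
       N (heron_op s S T X) <= N (heron_op s' S T X)) ->
  posdef_fun (mean_quotient s s').
Proof.
move=> hs' contr n t w; set Q := \sum_i \sum_j _.
pose lam : 'rV[R]_n := \row_i expR (2 * t i).
have lam0 i : 0 <= lam 0 i by rewrite mxE expR_ge0.
pose S := diag_mx (map_mx (real_complex R) lam).
(* The means with parameter s' are positive, so X is sent to the ones matrix. *)
pose X : 'M[R[i]]_n := \matrix_(i, j) ((heron_mean s' (lam 0 i) (lam 0 j))^-1)%:C.
have opE r : heron_op r S S X = \matrix_(i, j)
    (heron_mean r (lam 0 i) (lam 0 j) / heron_mean s' (lam 0 i) (lam 0 j))%:C.
  rewrite (@heron_opE R n r S S X 1%:M 1%:M lam lam) ?unitarymx1 //; last 2 first.
  - by rewrite trmx1 map_mx1 mulmx1 mul1mx.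
  - by rewrite trmx1 map_mx1 mulmx1 mul1mx.
  rewrite /heron_diag trmx1 map_mx1 !mulmx1 !mul1mx.
  by apply/matrixP => i j; rewrite !mxE -rmorphM.
have mean_gt0 i j : 0 < heron_mean s' (lam 0 i) (lam 0 j).
  by rewrite !mxE heron_mean_exp mulr_gt0 ?expR_gt0 ?heron_den_gt0.
have := contr n _ (@trace_norm_norm R n) S S X (psdmx_diag lam0) (psdmx_diag lam0).
have -> : heron_op s' S S X = const_mx 1.
  rewrite opE; apply/matrixP => i j.
  by rewrite [LHS]mxE divff ?(lt0r_neq0 (mean_gt0 i j)) // !mxE rmorph1.
move=> /le_trans /(_ (trace_norm_ones R n)).
have -> : heron_op s S S X = \matrix_(i, j) (mean_quotient s s' (t i - t j))%:C.
  rewrite opE; apply/matrixP => i j; rewrite !mxE !heron_mean_exp.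
  by rewrite -mulf_div divff ?mul1r // gt_eqF ?expR_gt0.
have [w0|w0] := leP (\sum_i w i ^+ 2) 0.
  have wi i : w i = 0.
    apply/eqP; rewrite -sqrf_eq0 eq_le sqr_ge0 andbT; apply: le_trans w0.
    by rewrite (bigD1 i) //= lerDl sumr_ge0 // => j _; exact: sqr_ge0.
  by move=> _; rewrite /Q big1 // => i _; rewrite big1 // => j _; rewrite wi !mul0r.
have := trace_norm_reflection (fun i j => mean_quotient s s' (t i - t j)) w0.
move=> /le_trans h /h{h}.
have -> : \sum_i mean_quotient s s' (t i - t i) = n%:R.
  rewrite (eq_bigr (fun=> 1)) ?sumr_const ?card_ord // => i _.
  by rewrite subrr /mean_quotient cosh0 !mulr1 !subrKC divr1.
have -> : \sum_i \sum_j w i * w j * mean_quotient s s' (t j - t i) = Q.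
  rewrite exchange_big; apply: eq_bigr => i _; apply: eq_bigr => j _.
  by rewrite (mulrC (w i)).
rewrite gerBl pmulr_rge0 // divr_gt0 //; exact.
Qed.

Lemma posdef_le_at0 (K : R -> R) t : posdef_fun K -> (forall x, K (- x) = K x) ->
  K t <= K 0.
Proof.
move=> pK Keven.
have := pK 2%N (fun i => if i == ord0 then t else 0)
  (fun i => if i == ord0 then 1 else -1).
rewrite !big_ord_recl !big_ord0 /= !subrr sub0r Keven subr0; lra.
Qed.

Lemma cosh_gt1 : 1 < cosh (1 : R).
Proof.
have : cosh (1 : R) ^+ 2 = 1 + sinh (1 : R) ^+ 2 by rewrite sinh2 addrC subrK.
have : 0 < sinh (1 : R).
  by rewrite /sinh divr_gt0 // subr_gt0 ltr_expR; lra.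
have := @cosh_gt0 R 1; nra.
Qed.

(** The case [s' < s], [1/2 < s'] is excluded by writing the quotient as
[c0 + c1 / (be + cosh t)], [be = s' / (1 - s') > 1], in which
[c1 = (s - s') / (1 - s')^2]. *)
Lemma posdef_params s s' : 0 <= s <= 1 -> 0 <= s' <= 1 ->
  posdef_fun (mean_quotient s s') -> s = s' \/ (s >= s' /\ s' <= 1 / 2).
Proof.
move=> hs hs' pK.
have coshN x : cosh (- x) = cosh x :> R by rewrite /cosh opprK addrC.
have ss' : s' <= s.
  have := posdef_le_at0 1 pK (fun x => _).
  rewrite /mean_quotient => /(_ ltac:(by move=> x; rewrite coshN)).
  rewrite cosh0 !mulr1 !subrKC divr1 ler_pdivrMr ?heron_den_gt0 // mul1r.
  have := cosh_gt1; nra.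
have [->|nss'] := eqVneq s s'; [by left|right; split=> //].
have lt_ss' : s' < s by rewrite lt_def nss' ss'.
have [//|s'2] := leP s' (1 / 2).
have /andP[s0 s1] := hs.
have s'1 : 0 < 1 - s' by lra.
pose be := s' / (1 - s').
have be1 : 1 < be by rewrite ltr_pdivlMr //; lra.
have c1 : 0 < (s - s') / (1 - s') ^+ 2 by rewrite divr_gt0 ?exprn_gt0 // subr_gt0.
case: (not_posdef be1 (c0 := (1 - s) / (1 - s')) c1).
move: pK; congr posdef_fun; apply/funext => t.
have d0 := heron_den_gt0 t hs'.
rewrite /mean_quotient /be; field.
by rewrite (mulrC (cosh t)) !gt_eqF.
Qed.

End Necessity.


Theorem proposition3p5 (R : realType) (s s' : R)
    (hs : 0 <= s <= 1) (hs' : 0 <= s' <= 1) :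
  (forall (n : nat) (N : 'M[R[i]]_n -> R), unitarily_invariant_norm N ->
     forall S T X : 'M[R[i]]_n, psdmx S -> psdmx T ->
       N (heron_op s S T X) <= N (heron_op s' S T X))
  <-> (s = s' \/ (s >= s' /\ s' <= 1 / 2)).
Proof.
split=> [contr|].
  exact: posdef_params hs hs' (contractive_posdef hs' contr).
move=> [-> //|[ss' s'2]] n N hN S T X pS pT.
have /andP[_ s1] := hs; have /andP[s'0 _] := hs'.
by apply: heron_op_norm_le => //; apply/andP.
Qed.
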